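(* Let $d \geq 2$ and $1 \leq k \leq d-1$ be integers. Then $$\underline{sa}_d^s(d+k) \geq 3(d-1).$$ In particular, $$\underline{sa}_d^s(2d-1) = 3(d-1).$$
   Context: Let $X=\{x_1,\dots,x_n\}\subset\mathbb{R}^d$ be a finite set (with $x_i\neq x_j$ for $i\ne j$) whose affine hull is $\mathbb{R}^d$, and let $P=\operatorname{conv}X$. Two distinct points $x_i,x_j\in X$ are strictly antipodal (in $X$) if there are different parallel supporting hyperplanes $H',H''$ of $P$ with $X\cap H'=\{x_i\}$ and $X\cap H''=\{x_j\}$. $sa(X)$ is the number of (unordered) strictly antipodal pairs of $X$. $X$ is in strictly convex position if $X=\operatorname{vert}P$ (the vertex set of $P$). $\mathcal{C}_d^s(n)$ is the family of all $X\subset\mathbb{R}^d$ with $|X|=n$, $\operatorname{aff}X=\mathbb{R}^d$, $X$ in strictly convex position, and $\underline{sa}_d^s(n):=\min\{sa(X)\mid X\in\mathcal{C}_d^s(n)\}$. *)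

(* Defs.v *)
From mathcomp Require Import all_boot all_order all_algebra.
From mathcomp Require Import finmap.
From mathcomp Require Import all_classical all_reals.
From mathcomp Require Import convex.

Set Implicit Arguments.
Unset Strict Implicit.
Unset Printing Implicit Defensive.

Import Order.TTheory GRing.Theory Num.Theory.
Local Open Scope classical_set_scope.
Local Open Scope ring_scope.

Section Geometry.
Variables (R : realType) (d : nat).
Local Notation point := 'rV[R]_d.

Definition dot (a x : point) : R := \sum_(i < d) a 0 i * x 0 i.

Definition hyperplane (a : point) (b : R) : set point := [set x | dot a x = b].

Definition conv (X : {fset point}) : set point :=
  smallest (@convex_set R point) [set` X].

Definition aff (X : {fset point}) : set point :=
  [set y | exists w : point -> R,
     \sum_(x <- X) w x = 1 /\ y = \sum_(x <- X) w x *: x].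

(* Replacing (a, b) by (-a, -b) covers either choice of closed half-space. *)
Definition supporting_hyperplane (P H : set point) : Prop :=
  exists a b, [/\ a != 0, H = hyperplane a b,
    (forall x, P x -> dot a x <= b) & P `&` H !=set0].

(* Hyperplanes are parallel when one is a translate of the other; this allows
   equality, which is excluded separately where needed. *)
Definition parallel (H H' : set point) : Prop :=
  exists v : point, H' = [set x + v | x in H].

(* The vertices of a polytope are its 0-dimensional faces, a face being the
   intersection with a supporting hyperplane. *)
Definition vert (P : set point) : set point :=
  [set v | exists2 H, supporting_hyperplane P H & P `&` H = [set v]].

Definition strictly_convex_position (X : {fset point}) : Prop :=
  [set` X] = vert (conv X).

Definition strictly_antipodal (X : {fset point}) (x y : point) : Prop :=
  [/\ x \in X, y \in X, x != y &
    exists H' H'', [/\ supporting_hyperplane (conv X) H' /\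
                         supporting_hyperplane (conv X) H'',
                       parallel H' H'', H' <> H'',
                       [set` X] `&` H' = [set x] &
                       [set` X] `&` H'' = [set y]]].

(* Unordered pairs are counted as two-element subsets of X. *)
Definition sa (X : {fset point}) : nat :=
  #|` [fset Y in fpowerset X |
        `[< exists x y, Y = [fset x; y]%fset /\ strictly_antipodal X x y >]]%fset|.

End Geometry.

Definition Cs (R : realType) (d n : nat) : set {fset 'rV[R]_d} :=
  [set X | [/\ #|` X|%fset = n, aff X = setT & strictly_convex_position X]].

(* The minimum of a set of naturals; the default value 0 is only returned for
   the empty set. *)
Definition min_nat (S : set nat) : nat := xget 0%N (S `&` lbound S).

Definition min_sa (R : realType) (d n : nat) : nat :=
  min_nat [set sa X | X in @Cs R d n].

(* Main.v *)
(* Strictly antipodal pairs are the pairs (unique maximum, unique minimum) of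
   linear functionals. To allow induction on the dimension, the points are kept
   fixed and a subspace W of functionals varies: projecting along x - y means
   restricting W to the functionals with equal values at x and y, and keeping a
   minimal set of points that still attains all maxima. Write deg for the degree
   in the graph of strictly antipodal pairs, d for dim W and n for the number of
   points, n <= 2d - 1, and let {x, y} be strictly antipodal.

   - If deg x = 1 and deg y <= 2 then n >= 2d. Indeed, on leaving the cone of
     functionals maximal at x and minimal at y along a generic line, a maximum
     at a new j and a minimum at a new j' appear simultaneously, so x - j and
     j' - y are parallel; d - 2 such pairs can be found successively.
   - If [x, y] is an edge then deg x, deg y >= 2 and deg x + deg y >= d + 2.
     Otherwise some direction keeps the gaps between y and the other neighbours
     of x, and between x and those of y. Where the line leaves the cone, adding a
     small multiple of a functional exposing the edge yields a new neighbour.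

   If [x, y] is not an edge, projecting along x - y loses two points and at least
   deg x + deg y - 1 >= 3 pairs. If it is an edge and n <= 2d - 2, projecting
   loses one point and at least max (deg x) (deg y) >= 3 pairs. If n = 2d - 1 and
   all pairs are edges, then either all degrees are at least 3, or the two
   neighbours of a vertex of degree 2 have degree at least d, and summing degrees
   gives 3(d - 1) pairs. Equality holds for a pyramid over a cross-polytope. *)
From HB Require Import structures.
Require Import Defs.
From mathcomp Require Import all_boot all_order all_algebra.
From mathcomp Require Import all_classical all_reals.
From mathcomp Require Import finmap convex interval_inference ring lra zify.

Set Implicit Arguments.
Unset Strict Implicit.
Unset Printing Implicit Defensive.

Import Order.TTheory GRing.Theory Num.Theory.
Local Open Scope ring_scope.

(** * Linear functionals, annihilators and perturbations *)

Section Dot.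
Variables (R : realType) (d : nat).
Implicit Types (a b x y f g : 'rV[R]_d) (t : R) (W : {vspace 'rV[R]_d}).
Implicit Types (s : seq 'rV[R]_d).

Lemma dotC a x : dot a x = dot x a.
Proof. by apply: eq_bigr => i _; rewrite mulrC. Qed.

Lemma dotDl a b x : dot (a + b) x = dot a x + dot b x.
Proof. by rewrite /dot -big_split; apply: eq_bigr => i _; rewrite mxE mulrDl. Qed.

Lemma dotZl t a x : dot (t *: a) x = t * dot a x.
Proof. by rewrite /dot mulr_sumr; apply: eq_bigr => i _; rewrite mxE mulrA. Qed.

Lemma dotNl a x : dot (- a) x = - dot a x.
Proof. by rewrite -scaleN1r dotZl mulN1r. Qed.

Lemma dot0l x : dot 0 x = 0.
Proof. by rewrite -(scale0r 0) dotZl mul0r. Qed.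

Lemma dotDr a x y : dot a (x + y) = dot a x + dot a y.
Proof. by rewrite !(dotC a) dotDl. Qed.

Lemma dotZr t a x : dot a (t *: x) = t * dot a x.
Proof. by rewrite !(dotC a) dotZl. Qed.

Lemma dotNr a x : dot a (- x) = - dot a x.
Proof. by rewrite !(dotC a) dotNl. Qed.

Lemma dotBr a x y : dot a (x - y) = dot a x - dot a y.
Proof. by rewrite dotDr dotNr. Qed.

Lemma dot_self_eq0 a : dot a a = 0 -> a = 0.
Proof.
move=> a0; apply/rowP => i; rewrite mxE; apply/eqP.
have := psumr_eq0P (fun j _ => sqr_ge0 (a 0 j) : 0 <= a 0 j * a 0 j) a0.
by move=> /(_ i isT)/eqP; rewrite mulf_eq0 orbb.
Qed.

(** The codomain is [R^o] so that evaluation is a linear map and [annih] can be built from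
    kernels. *)
Definition eval_at x a : R^o := dot a x.

Lemma eval_at_linear x : linear (eval_at x).
Proof. by move=> t a b; rewrite /eval_at dotDl dotZl. Qed.

HB.instance Definition _ x :=
  GRing.isLinear.Build R 'rV[R]_d R^o _ (eval_at x) (eval_at_linear x).

Definition annih (W : {vspace 'rV[R]_d}) (s : seq 'rV[R]_d) : {vspace 'rV[R]_d} :=
  foldr (fun x U => U :&: lker (linfun (eval_at x)))%VS W s.

Lemma mem_annih W s f :
  reflect (f \in W /\ forall x, x \in s -> dot f x = 0) (f \in annih W s).
Proof.
elim: s => [|x s IHs] /=; first by apply: (iffP idP) => [|[]].
rewrite memv_cap memv_ker lfunE /=.
apply: (iffP andP) => [[/IHs[fW fs] /eqP fx]|[fW fxs]].
  by split=> // z; rewrite inE => /predU1P[->|/fs].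
split; last by apply/eqP; apply: fxs; rewrite mem_head.
by apply/IHs; split=> // z zs; rewrite fxs // inE zs orbT.
Qed.

(** Each point costs at most one dimension, because its evaluation has image in a line. *)
Lemma dim_annih W s : (\dim W <= \dim (annih W s) + size s)%N.
Proof.
elim: s => [|x s IHs] /=; first by rewrite addn0.
set U := annih W s in IHs *; set h := linfun _.
have le1 : (\dim (h @: U) <= 1)%N by rewrite (leq_trans (dimvS (subvf _))) // dimvf.
rewrite (leq_trans IHs) // -(limg_ker_dim h U) addnS -addSn -addnA.
by rewrite [X in (_ <= X)%N]addSnnS leq_add2l addnC -[(_ _).+1]addn1 leq_add2l.
Qed.

Lemma dim_annih1 W x f : f \in W -> dot f x != 0 ->
  (\dim (annih W [:: x])).+1 = \dim W.
Proof.
move=> fW fx; have /= := dim_annih W [:: x]; rewrite addn1.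
suff : (\dim (annih W [:: x]) < \dim W)%N by rewrite /=; lia.
have sub : (annih W [:: x] <= W)%VS by rewrite /= capvSl.
rewrite (ltn_leqif (dimv_leqif_eq sub)); apply: contra fx => /eqP eqW.
by have /mem_annih[_ ->] : f \in annih W [:: x]; rewrite ?eqW ?mem_head.
Qed.

Lemma vspace_neq0 (W : {vspace 'rV[R]_d}) : (0 < \dim W)%N ->
  exists2 f, f \in W & f != 0.
Proof.
by move=> W0; exists (vpick W); rewrite ?memv_pick // vpick0 -dimv_eq0 -lt0n.
Qed.

Lemma annih_neq0 W s : (size s < \dim W)%N ->
  exists2 f, f \in annih W s & f != 0.
Proof.
move=> sW; apply: vspace_neq0; rewrite -(ltn_add2r (size s)).
exact: leq_trans sW (dim_annih W s).
Qed.

Lemma small_perturbation (s : seq 'rV[R]_d) (f g : 'rV[R]_d) :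
  exists2 e, 0 < e & forall x, x \in s ->
    (0 < dot f x -> 0 < dot (f + e *: g) x) /\
    (dot f x < 0 -> dot (f + e *: g) x < 0).
Proof.
(* Asking for the whole interval up to [e] lets the induction take minima. *)
suff [e e0 He] : exists2 e, 0 < e & forall e' x, 0 < e' <= e -> x \in s ->
    (0 < dot f x -> 0 < dot (f + e' *: g) x) /\
    (dot f x < 0 -> dot (f + e' *: g) x < 0).
  by exists e => // x xs; apply: He; rewrite // e0 lexx.
elim: s => [|x s [e e0 He]]; first by exists 1.
set m := `|dot f x| / (1 + `|dot g x|).
have den : 0 < 1 + `|dot g x| by rewrite ltr_pwDl ?ltr01.
have [fx0|fx0] := eqVneq (dot f x) 0.
  exists e => // e' z e'e; rewrite inE => /predU1P[->|/(He _ _ e'e)//].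
  by rewrite fx0 ltxx.
have m0 : 0 < m by rewrite divr_gt0 // normr_gt0.
exists (Num.min e m); first by rewrite lt_min e0 m0.
move=> e' z /andP[e'0]; rewrite le_min => /andP[e'e e'm].
rewrite inE => /predU1P[->|]; last by apply: He; rewrite e'0.
have lt : `|e' * dot g x| < `|dot f x|.
  rewrite normrM gtr0_norm //; apply: le_lt_trans (_ : m * `|dot g x| < _).
    by rewrite ler_wpM2r.
  rewrite /m mulrAC ltr_pdivrMr // ltr_pM2l ?normr_gt0 //; lra.
rewrite dotDl dotZl; split=> fx; move: lt;
  rewrite ?(gtr0_norm fx) ?(ltr0_norm fx) ltr_norml => /andP[]; lra.
Qed.

(** Genericity: [h] vanishes at a point of [s] only where all of [W] does. Zeros are removed one at
    a time, each by a perturbation too small to change the signs already fixed. *)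
Lemma generic_perturbation (W : {vspace 'rV[R]_d}) (s : seq 'rV[R]_d) f :
  f \in W -> exists2 h, h \in W & forall x, x \in s ->
    [/\ 0 < dot f x -> 0 < dot h x, dot f x < 0 -> dot h x < 0 &
        forall g, g \in W -> dot g x != 0 -> dot h x != 0].
Proof.
move=> fW; suff [h hW [sgn ne]] : exists2 h, h \in W &
    (forall x, x \in s -> (0 < dot f x -> 0 < dot h x) /\
                          (dot f x < 0 -> dot h x < 0)) /\
    (forall x, x \in s -> forall g, g \in W -> dot g x != 0 -> dot h x != 0).
  by exists h => // x xs; have [? ?] := sgn x xs; split=> //; apply: ne.
(* The induction runs over the points freed of zeros; the sign clause stays on all of [s]. *)
elim: {2}s => [|x r [h hW [sgn ne]]].
  by exists f => //; split=> // x; rewrite ?in_nil.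
have [hx|hx] := eqVneq (dot h x) 0; last first.
  exists h => //; split=> // z; rewrite inE => /predU1P[->//|]; exact: ne.
have [[g gW gx]|nog] := pselect (exists2 g, g \in W & dot g x != 0); last first.
  exists h => //; split=> // z; rewrite inE => /predU1P[-> g gW gx|]; last exact: ne.
  by case: nog; exists g.
have [e e0 He] := small_perturbation (s ++ r) h g.
exists (h + e *: g); first by rewrite memvD // memvZ.
split=> z.
  move=> zs; have [? ?] := He z ltac:(by rewrite mem_cat zs).
  by have [? ?] := sgn z zs; split; auto.
rewrite inE => /predU1P[-> _ _ _|zr g' g'W g'z].
  by rewrite dotDl dotZl hx add0r mulf_neq0 // gt_eqF.
have [Hp Hn] := He z ltac:(by rewrite mem_cat zr orbT).
have := ne z zr g' g'W g'z; rewrite neq_lt => /orP[/Hn|/Hp] H.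
  by rewrite lt_eqF.
by rewrite gt_eqF.
Qed.

(** [t] is the least ratio [dot c x / - dot f x] over the points with [dot f x < 0]. *)
Lemma first_exit (s : seq 'rV[R]_d) (c f : 'rV[R]_d) :
  (forall x, x \in s -> 0 < dot c x) -> (exists2 x, x \in s & dot f x < 0) ->
  exists2 t, 0 < t &
    (forall x, x \in s -> 0 <= dot (c + t *: f) x) /\
    (exists2 x, x \in s & dot (c + t *: f) x = 0).
Proof.
elim: s => [|x s IHs] cs [y ys fy]; first by [].
have cx := cs x (mem_head _ _).
have cs' z : z \in s -> 0 < dot c z by move=> zs; rewrite cs // inE zs orbT.
have [fx0|fx0] := leP 0 (dot f x).
  have [|t t0 [ge0 [z zs ez]]] := IHs cs'.
    by exists y => //; move: ys; rewrite inE => /predU1P[yx|//]; move: fy; rewrite yx; lra.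
  exists t => //; split; last by exists z; rewrite // inE zs orbT.
  move=> w; rewrite inE => /predU1P[->|/ge0//].
  by rewrite dotDl dotZl addr_ge0 ?mulr_ge0 // ltW.
pose u := dot c x / - dot f x.
have u0 : 0 < u by rewrite divr_gt0 ?oppr_gt0.
have ux : dot (c + u *: f) x = 0.
  by rewrite dotDl dotZl /u invrN mulrN mulNr divfK ?subrr // lt_eqF.
have [all0|] := pselect (forall z, z \in s -> 0 <= dot (c + u *: f) z).
  exists u => //; split; last by exists x; rewrite ?mem_head.
  by move=> z; rewrite inE => /predU1P[->|/all0//]; rewrite ux.
move=> /existsNP[z] /not_implyP[zs /negP]; rewrite -ltNge => fz.
have fz0 : dot f z < 0.
  rewrite -(pmulr_rlt0 (dot f z) u0).
  by have := cs' z zs; move: fz; rewrite dotDl dotZl; lra.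
have [|t t0 [ge0 [w ws ew]]] := IHs cs'; first by exists z.
exists t => //; split; last by exists w; rewrite // inE ws orbT.
move=> v; rewrite inE => /predU1P[->|/ge0//].
have tu : t <= u.
  have := ge0 z zs; move: fz; rewrite !dotDl !dotZl => fz ez.
  have : (u - t) * dot f z < 0 by lra.
  by rewrite nmulr_llt0 //; lra.
rewrite -ux !dotDl !dotZl lerD2l ler_wnM2r //; lra.
Qed.

End Dot.

(** * Configurations as seen by a subspace of functionals *)

Section Configuration.
Variables (R : realType) (N : nat) (I : finType) (p : I -> 'rV[R]_N).
Implicit Types (W : {vspace 'rV[R]_N}) (J B : {set I}) (f g h c : 'rV[R]_N).
Local Notation ev f i := (dot f (p i)).

Definition sa_pair W J (x y : I) : Prop :=
  [/\ x \in J, y \in J, x != y &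
      exists2 f, f \in W & forall k, k \in J ->
        (k != x -> ev f k < ev f x) /\ (k != y -> ev f y < ev f k)].

(** Full affine span and strictly convex position, as seen by the functionals of [W] alone. *)
Definition vertex_position W J : Prop :=
  (forall f, f \in W -> (forall i j, i \in J -> j \in J -> ev f i = ev f j) ->
     f = 0) /\
  (forall j, j \in J -> exists2 f, f \in W &
     forall k, k \in J -> k != j -> ev f k < ev f j).

(** Equality of the images of two points in the dual of [W], that is, after projection. *)
Definition identified W (i j : I) : Prop := forall g, g \in W -> ev g i = ev g j.

Lemma sa_pair_sym W J x y : sa_pair W J x y -> sa_pair W J y x.
Proof.
case=> xJ yJ xy [f fW Hf]; split; rewrite 1?eq_sym //.
exists (- f); first by rewrite memvN.
by move=> k kJ; have [H1 H2] := Hf k kJ; rewrite !dotNl !ltrN2; split.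
Qed.

Lemma mem_annih_diff W x y f :
  reflect (f \in W /\ ev f x = ev f y) (f \in annih W [:: p x - p y]).
Proof.
apply: (iffP (mem_annih _ _ _)) => [[fW fxy]|[fW fxy]].
  by split=> //; apply/eqP; rewrite -subr_eq0 -dotBr fxy ?mem_head.
by split=> // z; rewrite inE => /eqP->; rewrite dotBr fxy subrr.
Qed.

Lemma vertex_separated W J i j : vertex_position W J -> i \in J -> j \in J ->
  i != j -> exists2 g, g \in W & ev g i < ev g j.
Proof. by move=> [_ vert] iJ jJ ij; have [g gW Hg] := vert j jJ; exists g; auto. Qed.

Lemma vertex_identified W J i j : vertex_position W J -> i \in J -> j \in J ->
  identified W i j -> i = j.
Proof.
move=> pos iJ jJ same; apply/eqP; apply/negPn/negP => ij.
by have [g gW] := vertex_separated pos iJ jJ ij; rewrite same // ltxx.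
Qed.

(** The pair is the maximum and minimum of [f] with ties broken by [g]. Both come from a generic
    functional near [f + e *: g], which takes distinct values at distinct points of [J]. *)
Lemma lex_sa_pair W J f g : vertex_position W J -> (1 < #|J|)%N ->
  f \in W -> g \in W ->
  exists u v, sa_pair W J u v /\ forall k, k \in J ->
    [/\ ev f k <= ev f u, ev f v <= ev f k,
        ev f k = ev f u -> ev g k <= ev g u &
        ev f k = ev f v -> ev g v <= ev g k].
Proof.
move=> pos J1 fW gW.
pose s := [seq p i - p j | i <- enum I, j <- enum I].
have s_mem i j : p i - p j \in s by apply: allpairs_f; rewrite mem_enum.
have [e e0 He] := small_perturbation s f g.
have [|h hW Hh] := @generic_perturbation _ _ W s (f + e *: g).
  by rewrite memvD // memvZ.
have f_h i j : ev f i < ev f j -> ev h i < ev h j.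
  have [H _] := He _ (s_mem j i); have [H1 _ _] := Hh _ (s_mem j i).
  by rewrite -subr_gt0 -dotBr => /H/H1; rewrite dotBr subr_gt0.
have fg_h i j : ev f i = ev f j -> ev g i < ev g j -> ev h i < ev h j.
  move=> eij gij; have [H1 _ _] := Hh _ (s_mem j i).
  rewrite -subr_gt0 -dotBr; apply: H1.
  by rewrite dotDl dotZl !dotBr eij subrr add0r mulr_gt0 // subr_gt0.
have h_inj i j : i \in J -> j \in J -> i != j -> ev h i != ev h j.
  move=> iJ jJ ij; have [g' g'W g'ij] := vertex_separated pos iJ jJ ij.
  have [_ _ H] := Hh _ (s_mem i j).
  rewrite -subr_eq0 -dotBr; apply: (H g') => //.
  by rewrite dotBr subr_eq0 lt_eqF.
have /card_gt0P[k0 k0J] : (0 < #|J|)%N by lia.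
case: (@arg_maxP _ _ I k0 (mem J) (fun i => ev h i) k0J) => u uJ umax.
case: (@arg_minP _ _ I k0 (mem J) (fun i => ev h i) k0J) => v vJ vmin.
have {}umax k : k \in J -> ev h k <= ev h u by move/umax.
have {}vmin k : k \in J -> ev h v <= ev h k by move/vmin.
have uv : u != v.
  apply: contraTneq J1 => uv; rewrite -leqNgt.
  apply/card_le1P => i iJ j; rewrite inE; apply/idP/eqP => [jJ|->//].
  apply/eqP; apply/negPn/negP => ji; move: (h_inj _ _ jJ iJ ji).
  have := umax i iJ; have := umax j jJ; have := vmin i iJ; have := vmin j jJ.
  by rewrite uv => vj vi ju iu; case/eqP; lra.
exists u, v; split.
  split=> //; exists h => // k kJ; split=> kn.
    by rewrite lt_neqAle h_inj //; exact: umax.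
  by rewrite lt_neqAle h_inj 1?eq_sym //; exact: vmin.
move=> k kJ; have := umax k kJ; have := vmin k kJ => vk ku.
by split; [| |move=> E|move=> E]; rewrite leNgt; apply/negP => L;
  [have := f_h _ _ L|have := f_h _ _ L|have := fg_h _ _ (esym E) L|have := fg_h _ _ E L];
  lra.
Qed.

(** Source of new neighbours: optimising [c] with ties broken by [h] keeps the maximum at [x] but
    moves the minimum off [y], since [j] ties with [y] for [c] and lies lower for [h]. *)
Lemma sa_pair_at_tie W J c h x y j : vertex_position W J ->
  c \in W -> h \in W -> x \in J -> y \in J -> j \in J -> x != y ->
  (forall k, k \in J -> ev c k <= ev c x) ->
  (forall k, k \in J -> k != x -> ev c k = ev c x -> ev h k < ev h x) ->
  (forall k, k \in J -> ev c y <= ev c k) ->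
  ev c j = ev c y -> ev h j < ev h y ->
  exists v, [/\ sa_pair W J x v, v != y & ev c v = ev c y].
Proof.
move=> pos cW hW xJ yJ jJ xy xmax xuniq ymin ejy hjy.
have J1 : (1 < #|J|)%N by apply/card_gt1P; exists x, y; rewrite xJ yJ.
have [u [v [sa lex]]] := lex_sa_pair pos J1 cW hW.
have [uJ vJ _ _] := sa.
have ux : u = x.
  apply/eqP; apply/negPn/negP => ux; have [le _ lt _] := lex x xJ.
  have eux : ev c u = ev c x by apply/eqP; rewrite eq_le xmax.
  by have := xuniq u uJ ux eux; have := lt (esym eux); lra.
have evy : ev c v = ev c y.
  by apply/eqP; rewrite eq_le ymin // andbT; case: (lex y yJ).
exists v; split=> //; first by rewrite -ux.
apply: contraTneq hjy => vy; rewrite -leNgt.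
by have [_ _ _] := lex j jJ; rewrite vy; apply.
Qed.

(** The functionals with unique maximum at [x] and unique minimum at [y] form an open cone. The line
    through [c] leaves it in at least one direction, because [f] is not constant on [J]; hence [t]
    may be negative. *)
Lemma exit_point W J c f x y : vertex_position W J -> x \in J -> y \in J ->
  (forall k, k \in J ->
     (k != x -> ev c k < ev c x) /\ (k != y -> ev c y < ev c k)) ->
  f \in W -> f != 0 ->
  exists2 t, t != 0 &
    (forall k, k \in J ->
       ev (c + t *: f) y <= ev (c + t *: f) k <= ev (c + t *: f) x) /\
    ((exists2 j, j \in J & j != x /\ ev (c + t *: f) j = ev (c + t *: f) x) \/
     (exists2 j, j \in J & j != y /\ ev (c + t *: f) j = ev (c + t *: f) y)).
Proof.
move=> pos xJ yJ Hc fW f0.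
pose s := [seq p x - p k | k <- enum (J :\ x)] ++ [seq p k - p y | k <- enum (J :\ y)].
have sx k : k \in J -> k != x -> p x - p k \in s.
  by move=> kJ kx; rewrite mem_cat (map_f (fun k => p x - p k)) // mem_enum !inE kx.
have sy k : k \in J -> k != y -> p k - p y \in s.
  by move=> kJ ky; rewrite mem_cat (map_f (fun k => p k - p y)) ?orbT // mem_enum !inE ky.
have cs z : z \in s -> 0 < dot c z.
  rewrite mem_cat => /orP[] /mapP[k]; rewrite mem_enum !inE => /andP[kn kJ] ->;
  by rewrite dotBr subr_gt0; case: (Hc k kJ); auto.
have exit f1 : (exists2 z, z \in s & dot f1 z < 0) -> exists2 t, t != 0 &
    (forall k, k \in J ->
       ev (c + t *: f1) y <= ev (c + t *: f1) k <= ev (c + t *: f1) x) /\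
    ((exists2 j, j \in J & j != x /\ ev (c + t *: f1) j = ev (c + t *: f1) x) \/
     (exists2 j, j \in J & j != y /\ ev (c + t *: f1) j = ev (c + t *: f1) y)).
  move=> neg; have [t t0 [ge0 [z zs ez]]] := first_exit cs neg.
  exists t; first by rewrite gt_eqF.
  split=> [k kJ|].
    apply/andP; split.
      have [->//|ky] := eqVneq k y.
      by have := ge0 _ (sy k kJ ky); rewrite dotBr subr_ge0.
    have [->//|kx] := eqVneq k x.
    by have := ge0 _ (sx k kJ kx); rewrite dotBr subr_ge0.
  move: zs; rewrite mem_cat => /orP[] /mapP[k];
    rewrite mem_enum !inE => /andP[kn kJ] zE; [left|right]; exists k => //;
    by split=> //; move: ez; rewrite zE dotBr; lra.
have [|nof] := pselect (exists2 z, z \in s & dot f z < 0); first exact: exit.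
have fge z : z \in s -> 0 <= dot f z.
  by move=> zs; rewrite leNgt; apply/negP => fz; apply: nof; exists z.
have [|nonf] := pselect (exists2 z, z \in s & dot (- f) z < 0).
  move=> /exit[t t0 H]; exists (- t); first by rewrite oppr_eq0.
  by rewrite scaleNr -scalerN.
have fle z : z \in s -> dot f z <= 0.
  move=> zs; rewrite -oppr_ge0 -dotNl leNgt.
  by apply/negP => fz; apply: nonf; exists z.
have fx k : k \in J -> ev f k = ev f x.
  move=> kJ; have [->//|kx] := eqVneq k x.
  by have := fge _ (sx k kJ kx); have := fle _ (sx k kJ kx); rewrite dotBr; lra.
case/eqP: f0; apply: pos.1 => // i j iJ jJ; by rewrite !fx.
Qed.

End Configuration.

(** * A leaf whose neighbour has degree at most two *)

Section Degree.
Variables (R : realType) (N : nat) (I : finType) (p : I -> 'rV[R]_N).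
Implicit Types (W : {vspace 'rV[R]_N}) (J B : {set I}) (f g h c : 'rV[R]_N).
Local Notation ev f i := (dot f (p i)).

Section LeafAndNeighbour.
Variables (W : {vspace 'rV[R]_N}) (J : {set I}) (x y w : I).
Hypothesis pos : vertex_position p W J.
Hypothesis sa_xy : sa_pair p W J x y.
Hypothesis x_leaf : forall v, sa_pair p W J x v -> v = y.
Hypothesis y_nbrs : forall v, sa_pair p W J y v -> v = x \/ v = w.

(** Where [c + t *: f] leaves the cone, ties occur at both ends, since a tie at one end only would
    create a forbidden neighbour. For generic [c], simultaneous ties make [p x - p j] and
    [p j' - p y] parallel as seen by [W]. *)
Lemma parallel_step f : f \in W -> f != 0 -> ev f x = ev f y -> ev f w = ev f x ->
  exists j j', [/\ j \in J, j' \in J, ev f x < ev f j, ev f j' < ev f x &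
    forall g, g \in W -> ev g x = ev g y -> (ev g j = ev g x <-> ev g j' = ev g x)].
Proof.
move=> fW f0 fxy fw; have [xJ yJ xy [c0 c0W Hc0]] := sa_xy.
(* [c] vanishes at [Q j j'] when [j] ties with [x] and [j'] with [y] at the same [t]; by genericity
   all of [W] then vanishes there. *)
pose Q j j' := (ev f j' - ev f y) *: (p x - p j) + (ev f j - ev f x) *: (p j' - p y).
pose s := [seq p i - p j | i <- enum I, j <- enum I] ++
          [seq Q i j | i <- enum I, j <- enum I].
have s_mem i j : p i - p j \in s.
  by rewrite mem_cat; apply/orP; left; apply: allpairs_f; rewrite mem_enum.
have Q_mem i j : Q i j \in s.
  by rewrite mem_cat; apply/orP; right; apply: allpairs_f; rewrite mem_enum.
have [c cW Hc1] := generic_perturbation s c0W.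
have Hc k : k \in J -> (k != x -> ev c k < ev c x) /\ (k != y -> ev c y < ev c k).
  move=> kJ; have [H1 H2] := Hc0 k kJ; split=> kn; rewrite -subr_gt0 -dotBr.
    by have [H _ _] := Hc1 _ (s_mem x k); apply: H; rewrite dotBr subr_gt0 H1.
  by have [H _ _] := Hc1 _ (s_mem k y); apply: H; rewrite dotBr subr_gt0 H2.
have [t t0 [between ties]] := exit_point pos xJ yJ Hc fW f0.
set c' := c + t *: f in between ties *.
have c'W : c' \in W by rewrite memvD // memvZ.
have c'E i : ev c' i = ev c i + t * ev f i by rewrite dotDl dotZl.
have c'xy : ev c' y < ev c' x by rewrite !c'E fxy ltrD2r; apply: (Hc y yJ).1; rewrite eq_sym.
(* A tie only at the minimum would give the leaf [x] a second neighbour. *)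
have minmax : (exists2 j, j \in J & j != y /\ ev c' j = ev c' y) ->
              exists2 j, j \in J & j != x /\ ev c' j = ev c' x.
  move=> [j' j'J [j'y ej']]; apply: contrapT => nomax.
  have [h hW hj'] := vertex_separated pos j'J yJ j'y.
  have [|||||v [sav vy _]] := @sa_pair_at_tie _ _ _ p W J c' h x y j' pos c'W hW xJ yJ j'J xy.
  - by move=> k kJ; have /andP[] := between k kJ.
  - by move=> k kJ kx ek; case: nomax; exists k.
  - by move=> k kJ; have /andP[] := between k kJ.
  - by [].
  - by [].
  - by move/eqP: vy; apply; apply: x_leaf.
(* A tie only at the maximum would give [y] a neighbour tied with [x], which must be [w]; but [f]
   agrees at [w] and [x], so [c] would as well. *)
have maxmin : (exists2 j, j \in J & j != x /\ ev c' j = ev c' x) ->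
              exists2 j, j \in J & j != y /\ ev c' j = ev c' y.
  move=> [j jJ [jx ej]]; apply: contrapT => nomin.
  have [h hW hj] := vertex_separated pos jJ xJ jx.
  have Nc'W : - c' \in W by rewrite memvN.
  have yx : y != x by rewrite eq_sym.
  have [|||||v [sav vx ev']] := @sa_pair_at_tie _ _ _ p W J (- c') h y x j pos Nc'W hW yJ xJ jJ yx.
  - by move=> k kJ; have /andP[] := between k kJ; rewrite !dotNl lerN2.
  - move=> k kJ ky; rewrite !dotNl => /oppr_inj ek.
    by case: nomin; exists k.
  - by move=> k kJ; have /andP[] := between k kJ; rewrite !dotNl lerN2.
  - by rewrite !dotNl ej.
  - by [].
  - have [_ vJ _ _] := sav; have [vE|vE] := y_nbrs sav; first by rewrite vE eqxx in vx.
    move: ev'; rewrite !dotNl !c'E vE fw => /oppr_inj; have := (Hc v vJ).1 vx.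
    by rewrite vE; lra.
have [[j jJ [jx ej]] [j' j'J [j'y ej']]] :
    (exists2 j, j \in J & j != x /\ ev c' j = ev c' x) /\
    (exists2 j, j \in J & j != y /\ ev c' j = ev c' y).
  by case: ties => tie; split; auto.
have cj : ev c x - ev c j = t * (ev f j - ev f x) by move: ej; rewrite !c'E; lra.
have cj' : ev c j' - ev c y = t * (ev f y - ev f j') by move: ej'; rewrite !c'E; lra.
have QW g : g \in W -> dot g (Q j j') = 0.
  move=> gW; apply/eqP; apply/negPn/negP => gQ.
  have [_ _ /(_ g gW gQ)/eqP] := Hc1 _ (Q_mem j j'); apply.
  by rewrite dotDr !dotZr !dotBr cj cj'; ring.
have pos1 : 0 < t * (ev f j - ev f x) by rewrite -cj subr_gt0 (Hc j jJ).1.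
have pos2 : 0 < t * (ev f y - ev f j') by rewrite -cj' subr_gt0 (Hc j' j'J).2.
have fj : ev f j - ev f x != 0 by apply: contraTneq pos1 => ->; rewrite mulr0 ltxx.
have fj' : ev f j' - ev f y != 0.
  by rewrite -opprB oppr_eq0; apply: contraTneq pos2 => ->; rewrite mulr0 ltxx.
have equiv g : g \in W -> ev g x = ev g y -> ev g j = ev g x <-> ev g j' = ev g x.
  move=> gW gxy; have := QW g gW; rewrite dotDr !dotZr !dotBr => gQ.
  split=> e; apply/eqP; rewrite -subr_eq0; apply/eqP.
    by apply: (mulfI fj); move: gQ; rewrite e gxy; lra.
  by apply: (mulfI fj'); move: gQ; rewrite e gxy; lra.
(* The sign of [t] decides on which side of [x] each of the two points lies. *)
have [tpos|tneg|tz] := ltgtP 0 t.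
- rewrite !pmulr_rgt0 // in pos1 pos2.
  by exists j, j'; split=> //; lra.
- rewrite !nmulr_rgt0 // in pos1 pos2.
  exists j', j; split=> //; [lra|lra|].
  by move=> g gW gxy; have := equiv g gW gxy; tauto.
- by rewrite -tz eqxx in t0.
Qed.

(** Each new functional is constant on the pairs found so far, while its own pair lies strictly on
    either side, so that pair is new. Equality at [j] entails equality at [j'], so two points cost
    only the one condition [p j - p x]. *)
Lemma parallel_pairs r : (r.+2 <= \dim W)%N ->
  exists (Z : {set I}) (s : seq 'rV[R]_N), [/\ size s = r, Z \subset J, #|Z| = (2 * r)%N,
    [/\ x \notin Z, y \notin Z & w \notin Z] &
    forall g z, g \in annih W (p x - p y :: s) -> z \in Z -> ev g z = ev g x].
Proof.
elim: r => [|r IHr] dimW.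
  exists finset.set0, [::]; split; rewrite ?finset.sub0set ?cards0 ?muln0 ?inE //.
  by move=> g z _; rewrite inE.
have [Z [s [ss ZJ cZ [xZ yZ wZ] HZ]]] := IHr (ltnW dimW).
have [|f fA f0] := @annih_neq0 _ _ W [:: p w - p x, p x - p y & s].
  by rewrite /= ss.
have /mem_annih[fW Hf] := fA.
have fA' : f \in annih W (p x - p y :: s).
  by apply/mem_annih; split=> // z zs; apply: Hf; rewrite inE zs orbT.
have fxy : ev f x = ev f y.
  by apply/eqP; rewrite -subr_eq0 -dotBr Hf // !inE eqxx orbT.
have fw : ev f w = ev f x by apply/eqP; rewrite -subr_eq0 -dotBr Hf // mem_head.
have [j [j' [jJ j'J fj fj' equiv]]] := parallel_step fW f0 fxy fw.
have notin k : ev f k != ev f x -> [/\ k \notin Z, x != k, y != k & w != k].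
  move=> fk; split; apply: contra fk; first by move=> kZ; rewrite (HZ f k).
  - by move=> /eqP<-.
  - by move=> /eqP<-; rewrite fxy.
  - by move=> /eqP<-; rewrite fw.
have [jZ xj yj wj] := notin j ltac:(by rewrite gt_eqF).
have [j'Z xj' yj' wj'] := notin j' ltac:(by rewrite lt_eqF).
exists (j |: (j' |: Z)), (p j - p x :: s); split.
- by rewrite /= ss.
- by rewrite !finset.subUset !finset.sub1set jJ j'J ZJ.
- rewrite !cardsU1 !inE (negPf jZ) (negPf j'Z) orbF cZ.
  have -> : j != j' by apply: contraTneq fj => ->; rewrite -leNgt ltW.
  by rewrite mulnS addnA.
- by rewrite !inE !negb_or xZ yZ wZ xj yj wj xj' yj' wj'.
move=> g z /mem_annih[gW Hg].
have gxy : ev g x = ev g y by apply/eqP; rewrite -subr_eq0 -dotBr Hg // mem_head.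
have gj : ev g j = ev g x.
  by apply/eqP; rewrite -subr_eq0 -dotBr Hg // !inE eqxx orbT.
rewrite !inE => /or3P[/eqP->//|/eqP->|zZ]; first by apply/(equiv g gW gxy).
apply: HZ => //; apply/mem_annih; split=> // v; rewrite inE => /predU1P[->|vs];
  by rewrite Hg // !inE ?eqxx ?vs ?orbT.
Qed.

(** The [\dim W - 2] parallel pairs together with [x] and [y] give [2 * \dim W - 2] points. A last
    functional, constant on all of them, provides two more: a further parallel pair, or [w] and a
    point on the other side of [x]. *)
Lemma leaf_card : w \in J -> w != x -> w != y -> (2 * \dim W <= #|J|)%N.
Proof.
move=> wJ wx wy; have [xJ yJ xy [c cW Hc]] := sa_xy.
have card_le (Z : {set I}) (r : seq I) : Z \subset J -> uniq r ->
    all (mem J) r -> all (fun i => i \notin Z) r -> (size r + #|Z| <= #|J|)%N.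
  move=> ZJ ur rJ rZ; rewrite !cardE -size_cat uniq_leq_size //.
    rewrite cat_uniq ur enum_uniq andbT /=; apply/hasPn => i; rewrite mem_enum => iZ.
    by apply: contraL iZ => /(allP rZ).
  move=> i; rewrite mem_cat !mem_enum => /orP[/(allP rJ)//|]; exact: (fintype.subsetP ZJ).
have [d1|d2] := leqP (\dim W) 1.
  apply: leq_trans (_ : 2 <= _)%N; first by move: d1; clear; lia.
  by apply/card_gt1P; exists x, y.
have [|Z [s [ss ZJ cZ [xZ yZ wZ] HZ]]] := @parallel_pairs (\dim W - 2); first by move: d2; clear; lia.
have [|g gA g0] := @annih_neq0 _ _ W (p x - p y :: s).
  by rewrite /= ss; move: d2; clear; lia.
have /mem_annih[gW Hg] := gA.
have gxy : ev g x = ev g y by apply/eqP; rewrite -subr_eq0 -dotBr Hg // mem_head.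
have [gw|gw] := eqVneq (ev g w) (ev g x).
  have [j [j' [jJ j'J gj gj' _]]] := parallel_step gW g0 gxy gw.
  have jZ : j \notin Z by apply: contraTN gj => /(HZ g j gA)->; rewrite ltxx.
  have j'Z : j' \notin Z by apply: contraTN gj' => /(HZ g j' gA)->; rewrite ltxx.
  have xj : x != j by apply: contraTneq gj => <-; rewrite ltxx.
  have yj : y != j by apply: contraTneq gj => <-; rewrite gxy ltxx.
  have xj' : x != j' by apply: contraTneq gj' => <-; rewrite ltxx.
  have yj' : y != j' by apply: contraTneq gj' => <-; rewrite gxy ltxx.
  have jj' : j != j' by apply: contraTneq gj' => <-; rewrite -leNgt ltW.
  have := card_le Z [:: x; y; j; j'] ZJ; rewrite /= !inE !negb_or xy.
  rewrite xj xj' yj yj' jj'.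
  by rewrite xJ yJ jJ j'J xZ yZ jZ j'Z cZ => /(_ isT isT isT); move: d2; clear; lia.
wlog {gw} gw : g g0 gA gW Hg gxy / ev g x < ev g w.
  move=> H; move: gw; rewrite neq_lt => /orP[gw|]; last by apply: H.
  apply: (H (- g)); rewrite ?oppr_eq0 ?memvN //.
  - by move=> z /Hg; rewrite dotNl => ->; rewrite oppr0.
  - by rewrite !dotNl gxy.
  - by rewrite !dotNl ltrN2.
(* If [g] were nonnegative on [J], lexicographic optimisation of [(-g, c)] would
   give [x] a strictly antipodal partner on the side of [w]. *)
have [[j jJ gj]|nog] := pselect (exists2 j, j \in J & ev g j < ev g x); last first.
  have J1 : (1 < #|J|)%N by apply/card_gt1P; exists x, y.
  have NgW : - g \in W by rewrite memvN.
  have [u [v [sa lex]]] := lex_sa_pair pos J1 NgW cW.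
  have [uJ vJ _ _] := sa.
  have ux : u = x.
    apply/eqP; apply/negPn/negP => ux; have [le _ lt _] := lex x xJ.
    have eux : ev (- g) x = ev (- g) u.
      apply/eqP; rewrite eq_le le /= !dotNl lerN2 leNgt; apply/negP => gu.
      by apply: nog; exists u.
    by have := (Hc u uJ).1 ux; have := lt eux; lra.
  have vy : v = y by apply: x_leaf; rewrite -ux.
  by have [_ + _ _] := lex w wJ; rewrite vy !dotNl; lra.
have jZ : j \notin Z by apply: contraTN gj => /(HZ g j gA)->; rewrite ltxx.
have xj : x != j by apply: contraTneq gj => <-; rewrite ltxx.
have yj : y != j by apply: contraTneq gj => <-; rewrite gxy ltxx.
have wj : w != j by apply: contraTneq gj => <-; rewrite -leNgt ltW.
have := card_le Z [:: x; y; w; j] ZJ; rewrite /= !inE !negb_or xy.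
rewrite xj yj wj [x == w]eq_sym [y == w]eq_sym wx wy.
by rewrite xJ yJ wJ jJ xZ yZ wZ jZ cZ => /(_ isT isT isT); move: d2; clear; lia.
Qed.

End LeafAndNeighbour.
End Degree.

(** * Degree bounds, edges and projection *)

Section EdgesAndProjection.
Variables (R : realType) (N : nat) (I : finType) (p : I -> 'rV[R]_N).
Implicit Types (W : {vspace 'rV[R]_N}) (J B : {set I}) (f g h c : 'rV[R]_N).
Local Notation ev f i := (dot f (p i)).

Definition nbrs W J (x : I) : {set I} := [set v | `[< sa_pair p W J x v >]].

(** Ordered pairs: each strictly antipodal pair counts twice, whence the factor 6 in the bounds
    below. *)
Definition sa_set W J : {set I * I} := [set q | `[< sa_pair p W J q.1 q.2 >]].

Local Notation glue W x y := (annih W [:: p x - p y]).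

(* The functionals equal at [x] and [y] are those of the projection along
   [p x - p y]; an edge is a fibre over a vertex of the projected polytope. *)
Definition is_edge W J (x y : I) : Prop := exists2 h, h \in glue W x y &
  forall k, k \in J -> ev h k < ev h x \/ identified p (glue W x y) k x.

(** For [B] inside [J] this says that both have the same convex hull in the projection given by
    [W]. *)
Definition dominates W B J : Prop :=
  forall f i, f \in W -> i \in J -> exists2 j, j \in B & ev f i <= ev f j.

Lemma nbrsP W J x v : reflect (sa_pair p W J x v) (v \in nbrs W J x).
Proof. by rewrite inE; apply: asboolP. Qed.

Lemma sa_setP W J q : reflect (sa_pair p W J q.1 q.2) (q \in sa_set W J).
Proof. by rewrite inE; apply: asboolP. Qed.

(** Otherwise a nonzero functional with equal values at [x] and [y] would be constant on [J]. *)
Lemma third_point W J x y : vertex_position p W J -> (1 < \dim W)%N ->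
  x \in J -> y \in J -> exists w, [/\ w \in J, w != x & w != y].
Proof.
move=> pos d2 xJ yJ; apply: contrapT => no.
have [|f /mem_annih_diff[fW fxy] f0] := @annih_neq0 _ _ W [:: p x - p y]; first by [].
case/eqP: f0; apply: pos.1 => //.
have fk k : k \in J -> ev f k = ev f x.
  move=> kJ; have [->//|kx] := eqVneq k x; have [->//|ky] := eqVneq k y.
  by case: no; exists k.
by move=> i j iJ jJ; rewrite !fk.
Qed.

(** Below 4, one endpoint is a leaf and the other has degree at most 2, which [leaf_card] excludes
    for so few points. *)
Lemma degree_sum_ge4 W J x y : vertex_position p W J -> (1 < \dim W)%N ->
  (#|J| < 2 * \dim W)%N -> sa_pair p W J x y ->
  (4 <= #|nbrs W J x| + #|nbrs W J y|)%N.
Proof.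
move=> pos d2 cJ sa; rewrite leqNgt; apply/negP => lt4.
have leaf u v : sa_pair p W J u v -> (#|nbrs W J u| <= 1)%N ->
    (#|nbrs W J v| <= 2)%N -> False.
  move=> suv u1 v2; have [uJ vJ uv _] := suv.
  have vu : u \in nbrs W J v by apply/nbrsP/sa_pair_sym.
  have [w [wJ wu wv] Hw] : exists2 w, [/\ w \in J, w != u & w != v] &
      forall z, sa_pair p W J v z -> z = u \/ z = w.
    have nbrE z : sa_pair p W J v z -> z \in nbrs W J v by move/nbrsP.
    (* When [v] has no second neighbour, any third point can play the role of [w]. *)
    have [noz|[w]] := set_0Vmem (nbrs W J v :\ u).
      have [w Hw] := third_point pos d2 uJ vJ; exists w => // z /nbrE zv.
      left; apply/eqP; apply/negPn/negP => zu.
      have : z \in nbrs W J v :\ u by rewrite in_setD1 zu.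
      by rewrite noz inE.
    rewrite in_setD1 => /andP[wu wv]; have /nbrsP[_ wJ vw _] := wv.
    exists w; first by split=> //; rewrite eq_sym.
    move=> z /nbrE; have <- : [set u; w] = nbrs W J v.
      apply/eqP; rewrite eqEcard finset.subUset !finset.sub1set vu wv.
      by rewrite cards2 eq_sym wu.
    by rewrite !inE => /orP[] /eqP; auto.
  have u_leaf z : sa_pair p W J u z -> z = v.
    move=> /nbrsP zu; move/nbrsP: suv => vN; apply/eqP; move: u1.
    by apply: contraLR => zv; rewrite -ltnNge; apply/card_gt1P; exists z, v.
  have := leaf_card pos suv u_leaf Hw wJ wu wv.
  by rewrite leqNgt cJ.
have [xJ yJ xy _] := sa; have say := sa_pair_sym sa.
have x1 : (0 < #|nbrs W J x|)%N by apply/card_gt0P; exists y; apply/nbrsP.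
have y1 : (0 < #|nbrs W J y|)%N by apply/card_gt0P; exists x; apply/nbrsP.
have [x2|x2] := leqP #|nbrs W J x| 1.
  by apply: (leaf x y sa x2); move: lt4 x1; clear; lia.
by apply: (leaf y x say); move: lt4 x2 y1; clear; lia.
Qed.

(** Maximising the edge functional [h] with ties broken by [c] gives [x]. The corresponding minimum
    differs from [y]: otherwise all of [J] would project to one point, although the glued space is
    nonzero. *)
Lemma edge_degree_ge2 W J x y : vertex_position p W J -> (1 < \dim W)%N ->
  sa_pair p W J x y -> is_edge W J x y -> (1 < #|nbrs W J x|)%N.
Proof.
move=> pos d2 sa [h /mem_annih_diff[hW hxy] edge]; have [xJ yJ xy [c cW Hc]] := sa.
have J1 : (1 < #|J|)%N by apply/card_gt1P; exists x, y.
have [u [v [suv lex]]] := lex_sa_pair pos J1 hW cW; have [uJ vJ _ _] := suv.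
have hmax k : k \in J -> ev h k <= ev h x.
  move=> kJ; case: (edge k kJ) => [/ltW//|same].
  by rewrite same //; apply/mem_annih_diff.
have ux : u = x.
  apply/eqP; apply/negPn/negP => ux; have [le _ lt _] := lex x xJ.
  have eux : ev h x = ev h u by apply/eqP; rewrite eq_le le hmax.
  by have := (Hc u uJ).1 ux; have := lt eux; lra.
apply/card_gt1P; exists v, y; split; [apply/nbrsP; by rewrite -ux|exact/nbrsP|].
apply/negP => /eqP vy.
have [|g gA g0] := @annih_neq0 _ _ W [:: p x - p y]; first by [].
have /mem_annih_diff[gW gxy] := gA; case/eqP: g0; apply: pos.1 => //.
have gk k : k \in J -> ev g k = ev g x.
  move=> kJ; case: (edge k kJ) => [lt|->//].
  by have [_ + _ _] := lex k kJ; rewrite vy -hxy; lra.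
by move=> i j iJ jJ; rewrite !gk.
Qed.

Lemma edge_degree_sum W J x y : vertex_position p W J -> (1 < \dim W)%N ->
  sa_pair p W J x y -> is_edge W J x y ->
  (\dim W + 2 <= #|nbrs W J x| + #|nbrs W J y|)%N.
Proof.
move=> pos d2 sa edge; have [xJ yJ xy [c cW Hc]] := sa.
have := edge_degree_ge2 pos d2 sa edge; have sa' := sa_pair_sym sa.
have yN : y \in nbrs W J x by apply/nbrsP.
have xN : x \in nbrs W J y by apply/nbrsP.
rewrite (cardsD1 y) yN => /card_gt0P[v0]; rewrite in_setD1 => /andP[v0y v0N].
rewrite (cardsD1 x (nbrs W J y)) xN leqNgt; apply/negP => lt.
pose s := [seq p v - p y | v <- enum (nbrs W J x :\ y)] ++
          [seq p v - p x | v <- enum (nbrs W J y :\ x)].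
(* If the bound fails, the conditions in [s] are fewer than [\dim W], so some nonzero [f] preserves
   all these gaps. *)
have [|f /mem_annih[fW Hf] f0] := @annih_neq0 _ _ W s.
  by rewrite size_cat !size_map -!cardE; move: lt; clear; lia.
have fy v : v \in nbrs W J x -> v != y -> ev f v = ev f y.
  move=> vN vy; apply/eqP; rewrite -subr_eq0 -dotBr Hf // mem_cat; apply/orP; left.
  by apply/mapP; exists v; rewrite // mem_enum in_setD1 vy.
have fx v : v \in nbrs W J y -> v != x -> ev f v = ev f x.
  move=> vN vx; apply/eqP; rewrite -subr_eq0 -dotBr Hf // mem_cat; apply/orP; right.
  by apply/mapP; exists v; rewrite // mem_enum in_setD1 vx.
have [t t0 [between ties]] := exit_point pos xJ yJ Hc fW f0.
set c' := c + t *: f in between ties *.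
have c'W : c' \in W by rewrite memvD // memvZ.
have c'E i : ev c' i = ev c i + t * ev f i by rewrite dotDl dotZl.
(* If [c'] were constant on [J] it would be 0 and [c] a multiple of [f]; but [f] agrees at [y] and
   the second neighbour [v0], where [c] differs. *)
have c'xy : ev c' y < ev c' x.
  rewrite lt_neqAle; have /andP[-> _] := between x xJ; rewrite andbT.
  apply/negP => /eqP exy; have c'0 : c' = 0.
    have c'k k : k \in J -> ev c' k = ev c' x.
      by move=> kJ; have := between k kJ; rewrite exy => /le_anti.
    by apply: pos.1 => // i j iJ jJ; rewrite !c'k.
  have /nbrsP[_ v0J _ _] := v0N; have := (Hc v0 v0J).2 v0y.
  have := c'E v0; have := c'E y; rewrite c'0 !dot0l (fy v0) //; lra.
have [h hA Hh] := edge; have /mem_annih_diff[hW hxy] := hA.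
(* Off the direction [x - y] the glued functionals see everything, and [c']
   separates along it. *)
have same k z : k \in J -> z \in J -> identified p (glue W x y) k z ->
    ev c' k = ev c' z -> k = z.
  move=> kJ zJ kz ek; apply: (vertex_identified pos) => // g gW.
  pose a := (ev g x - ev g y) / (ev c' x - ev c' y).
  have gA : g - a *: c' \in glue W x y.
    apply/mem_annih_diff; split; first by rewrite memvB // memvZ.
    rewrite !dotDl !dotNl !dotZl.
    have : a * (ev c' x - ev c' y) = ev g x - ev g y.
      by rewrite divfK // subr_eq0 gt_eqF.
    lra.
  by have := kz _ gA; rewrite !dotDl !dotNl !dotZl ek; lra.
have xyS : identified p (glue W x y) y x by move=> g /mem_annih_diff[_ ->].
have hx k : k \in J -> k != x -> ev c' k = ev c' x -> ev h k < ev h x.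
  by move=> kJ kx ek; case: (Hh k kJ) => // /same E; rewrite E ?eqxx in kx.
have hy k : k \in J -> k != y -> ev c' k = ev c' y -> ev h k < ev h y.
  move=> kJ ky ek; rewrite -hxy; case: (Hh k kJ) => // kx.
  have E : k = y by apply: same => // g gA; rewrite kx // xyS.
  by rewrite E eqxx in ky.
(* The neighbour found at the exit ties under [c'] with the old endpoint. As [f] agrees at both, [c]
   would too. *)
case: ties => -[j jJ [jn ej]].
  have yx : y != x by rewrite eq_sym.
  have [||||||v [sav vx ev']] := @sa_pair_at_tie _ _ _ p W J (- c') h y x j pos _ hW yJ xJ jJ yx.
  - by rewrite memvN.
  - by move=> k kJ; have /andP[] := between k kJ; rewrite !dotNl lerN2.
  - by move=> k kJ ky; rewrite !dotNl => /oppr_inj; apply: hy.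
  - by move=> k kJ; have /andP[] := between k kJ; rewrite !dotNl lerN2.
  - by rewrite !dotNl ej.
  - exact: hx.
  have [_ vJ _ _] := sav; have := (Hc v vJ).1 vx.
  by move: ev'; rewrite !dotNl !c'E fx //; [lra|apply/nbrsP].
have [|||||v [sav vy ev']] := @sa_pair_at_tie _ _ _ p W J c' h x y j pos c'W hW xJ yJ jJ xy.
- by move=> k kJ; have /andP[] := between k kJ.
- exact: hx.
- by move=> k kJ; have /andP[] := between k kJ.
- by [].
- exact: hy.
have [_ vJ _ _] := sav; have := (Hc v vJ).2 vy.
by move: ev'; rewrite !c'E fy //; [lra|apply/nbrsP].
Qed.

(** In an inclusion-minimal dominating set, what prevents the removal of [b] is a functional maximal
    over [B] at [b] alone. *)
Lemma minimal_dominating W J : exists B, [/\ B \subset J, dominates W B J &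
  forall b, b \in B -> exists2 f, f \in W &
    forall k, k \in B -> k != b -> ev f k < ev f b].
Proof.
pose P B := `[< B \subset J /\ dominates W B J >].
have PJ : P J by apply/asboolP; split=> // f i _ iJ; exists i.
have [B /minsetP[/asboolP[BJ dom] min] _] := minset_exists PJ.
exists B; split=> // b bB; apply: contrapT => nof.
have : P (B :\ b).
  apply/asboolP; split; first exact: fintype.subset_trans (finset.subsetDl _ _) BJ.
  move=> f i fW iJ; apply: contrapT => noj; apply: nof; exists f => // k kB kb.
  have [j jB ij] := dom f i fW iJ.
  have lt z : z \in B -> z != b -> ev f z < ev f i.
    move=> zB zb; rewrite ltNge; apply/negP => fz.
    by apply: noj; exists z; rewrite // in_setD1 zb.
  have jb : j = b.
    by apply/eqP; apply/negPn/negP => jb; have := lt j jB jb; lra.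
  by rewrite -jb; exact: lt_le_trans (lt k kB kb) ij.
move=> /min -/(_ (finset.subsetDl _ _)) E.
by move: bB; rewrite -E !inE eqxx.
Qed.

Section Dominating.
Variables (W W' : {vspace 'rV[R]_N}) (J B : {set I}).
Hypothesis pos : vertex_position p W J.
Hypothesis sub : (W' <= W)%VS.
Hypothesis BJ : B \subset J.
Hypothesis dom : dominates W' B J.

Lemma dominating_position : (0 < #|J|)%N ->
  (forall b, b \in B -> exists2 f, f \in W' &
     forall k, k \in B -> k != b -> ev f k < ev f b) ->
  vertex_position p W' B.
Proof.
move=> /card_gt0P[i0 i0J] vert; split=> // f fW' fB.
have [b bB _] := dom fW' i0J.
have fb i : i \in J -> ev f i = ev f b.
  move=> iJ; apply/eqP; rewrite eq_le; apply/andP; split.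
    by have [j jB] := dom fW' iJ; rewrite (fB j b).
  have NfW' : - f \in W' by rewrite memvN.
  by have [j jB] := dom NfW' iJ; rewrite !dotNl lerN2 (fB j b).
apply: pos.1; first exact: (subvP sub).
by move=> i j iJ jJ; rewrite !fb.
Qed.

(** If some [g] were larger at [i] than at [j], tilting [f] slightly towards [g] would make [i]
    exceed every point of [B]. *)
Lemma max_identified f i j : f \in W' -> j \in B ->
  (forall k, k \in B -> k != j -> ev f k < ev f j) ->
  i \in J -> ev f j <= ev f i -> identified p W' i j.
Proof.
move=> fW' jB jmax iJ ji.
have fij : ev f i = ev f j.
  apply/eqP; rewrite eq_le ji andbT; have [k kB le] := dom fW' iJ.
  by have [<-//|kj] := eqVneq k j; have := jmax k kB kj; lra.
suff le g : g \in W' -> ev g i <= ev g j.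
  move=> g gW'; apply/eqP; rewrite eq_le le //=.
  by rewrite -lerN2 -!dotNl le // memvN.
move=> gW'; rewrite leNgt; apply/negP => gij.
pose s := [seq p j - p k | k <- enum I].
have [e e0 He] := small_perturbation s f g.
have hW' : f + e *: g \in W' by rewrite memvD // memvZ.
have [k kB] := dom hW' iJ; rewrite leNgt; apply/negP; rewrite negbK.
have hj : ev (f + e *: g) j < ev (f + e *: g) i.
  by rewrite !dotDl !dotZl fij ltrD2l ltr_pM2l.
have [->//|kj] := eqVneq k j; apply: lt_trans hj.
have [|H _] := He (p j - p k); first by apply: map_f; rewrite mem_enum.
by rewrite -subr_gt0 -dotBr; apply: H; rewrite dotBr subr_gt0 jmax.
Qed.

(** A functional exposing the projected pair is optimised over [J] with ties broken by [g], and
    [max_identified] places the optima over [j] and [l]. The choice of [g] prescribes which point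
    over [j] is reached. *)
Lemma sa_pair_lift g j l : (1 < #|J|)%N -> sa_pair p W' B j l -> g \in W ->
  exists u v, [/\ sa_pair p W J u v, identified p W' u j, identified p W' v l &
    forall k, k \in J -> identified p W' k j -> ev g k <= ev g u].
Proof.
move=> J1 [jB lB jl [f fW' Hf]] gW.
have fW : f \in W by exact: (subvP sub).
have [u [v [suv lex]]] := lex_sa_pair pos J1 fW gW; have [uJ vJ _ _] := suv.
have jJ : j \in J by exact: (fintype.subsetP BJ).
have lJ : l \in J by exact: (fintype.subsetP BJ).
have uj : identified p W' u j.
  apply: (@max_identified f) => //; first by move=> k kB kj; apply: (Hf k kB).1.
  by case: (lex j jJ).
exists u, v; split=> //.
  apply: (@max_identified (- f)); rewrite ?memvN //.
    by move=> k kB kl; rewrite !dotNl ltrN2; apply: (Hf k kB).2.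
  by rewrite !dotNl lerN2; case: (lex l lJ).
by move=> k kJ kj; have [_ _ H _] := lex k kJ; apply: H; rewrite kj // uj.
Qed.

End Dominating.

End EdgesAndProjection.

(** * Counting pairs and induction on the dimension *)

Section Counting.
Variables (R : realType) (N : nat) (I : finType) (p : I -> 'rV[R]_N).
Implicit Types (W : {vspace 'rV[R]_N}) (J B : {set I}) (f g h c : 'rV[R]_N).
Local Notation ev f i := (dot f (p i)).
Local Notation glue W x y := (annih W [:: p x - p y]).
Local Notation nbrs := (nbrs p).
Local Notation sa_set := (sa_set p).
Local Notation vertex_position := (vertex_position p).

Lemma mem_sa_set W J x y : ((x, y) \in sa_set W J) = (y \in nbrs W J x).
Proof. by rewrite !inE. Qed.

Lemma nbrs_sym W J x y : (x \in nbrs W J y) = (y \in nbrs W J x).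
Proof. by apply/nbrsP/nbrsP => /sa_pair_sym. Qed.

Lemma nbrs_neq W J x y : y \in nbrs W J x -> x != y.
Proof. by case/nbrsP. Qed.

Lemma card_sa_set W J : #|sa_set W J| = (\sum_(x in J) #|nbrs W J x|)%N.
Proof.
rewrite -sum1_card (partition_big (fun q : I * I => q.1) (mem J)) /=; last first.
  by move=> q /sa_setP[].
apply: eq_bigr => x xJ; rewrite -sum1_card.
rewrite (reindex_onto (fun v => (x, v)) (fun q : I * I => q.2)) /=; last first.
  by move=> [q1 q2] /= /andP[_ /eqP->].
by apply: eq_bigl => v; rewrite mem_sa_set !eqxx !andbT.
Qed.

Definition touching W J (A : {set I}) : {set I * I} :=
  [set q in sa_set W J | (q.1 \in A) || (q.2 \in A)].

Lemma mem_touching W J A u v :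
  ((u, v) \in touching W J A) = (v \in nbrs W J u) && ((u \in A) || (v \in A)).
Proof. by rewrite inE mem_sa_set. Qed.

Lemma card_touching_edge W J x y : sa_pair p W J x y ->
  (2 * (#|nbrs W J x| + #|nbrs W J y|) - 2 <= #|touching W J [set x; y]|)%N.
Proof.
move=> sa; have xy : x != y by case: sa.
have yN : y \in nbrs W J x by apply/nbrsP.
have xN : x \in nbrs W J y by rewrite nbrs_sym.
have dx := cardsD1 y (nbrs W J x); have dy := cardsD1 x (nbrs W J y).
rewrite yN in dx; rewrite xN in dy.
(* The first two lists already contain [(x, y)] and [(y, x)], so the last two omit them. *)
pose L := [seq (x, v) | v <- enum (nbrs W J x)] ++
  [seq (y, v) | v <- enum (nbrs W J y)] ++
  [seq (v, x) | v <- enum (nbrs W J x :\ y)] ++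
  [seq (v, y) | v <- enum (nbrs W J y :\ x)].
have <- : size L = (2 * (#|nbrs W J x| + #|nbrs W J y|) - 2)%N.
  rewrite !size_cat !size_map -!cardE; move: dx dy; clear; lia.
rewrite cardE; apply: uniq_leq_size.
  have inj1 (z : I) : injective (fun v : I => (z, v)) by move=> ? ? [].
  have inj2 (z : I) : injective (fun v : I => (v, z)) by move=> ? ? [].
  rewrite !cat_uniq !map_inj_uniq ?enum_uniq //= !andbT.
  apply/and3P; split; apply/hasPn => q; rewrite ?mem_cat.
  - move=> /or3P[] /mapP[v]; rewrite mem_enum ?in_setD1 => vN ->; apply/mapP => -[z].
    + by rewrite mem_enum => _ [E]; rewrite E eqxx in xy.
    + by rewrite mem_enum => zN [E _]; move: vN; rewrite E => /andP[_ /nbrs_neq/eqP].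
    + by rewrite mem_enum => zN [E _]; move: vN; rewrite E eqxx.
  - move=> /orP[] /mapP[v]; rewrite mem_enum ?in_setD1 => vN ->; apply/mapP => -[z].
    + by rewrite mem_enum => zN [E _]; move: vN; rewrite E eqxx.
    + by rewrite mem_enum => zN [E _]; move: vN; rewrite E => /andP[_ /nbrs_neq/eqP].
  - move=> /mapP[v _ ->]; apply/mapP => -[z _ [_ E]].
    by rewrite E eqxx in xy.
move=> q; rewrite !mem_cat mem_enum => /or4P[] /mapP[v];
  rewrite mem_enum ?in_setD1 => vN ->; rewrite mem_touching ?set21 ?set22 ?orbT andbT //.
- by rewrite nbrs_sym; case/andP: vN.
- by rewrite nbrs_sym; case/andP: vN.
Qed.

Section Gluing.
Variables (W : {vspace 'rV[R]_N}) (J B : {set I}) (x y : I).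
Local Notation W' := (glue W x y).
Hypothesis pos : vertex_position W J.
Hypotheses (xJ : x \in J) (yJ : y \in J) (xy : x != y).
Hypothesis BJ : B \subset J.
Hypothesis dom : dominates p W' B J.

Let glue_sub : (W' <= W)%VS.
Proof. by apply/subvP => g /mem_annih[]. Qed.

Let J1 : (1 < #|J|)%N.
Proof. by apply/card_gt1P; exists x, y. Qed.

Let yx_identified : identified p W' y x.
Proof. by move=> g /mem_annih_diff[]. Qed.

(** By [fibre_eq] at most one point of [B] lies over the common image of [x] and [y]. *)
Definition fibre : {set I} := [set k in B | `[< identified p W' k x >]].

Lemma fibreP k : reflect (k \in B /\ identified p W' k x) (k \in fibre).
Proof.
by rewrite inE; apply: (iffP andP) => -[kB]; [move/asboolP|move=> kx; split=> //; apply/asboolP].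
Qed.

Hypothesis posB : vertex_position W' B.

(** Pairs avoiding the fibre lift injectively, as the glued functionals tell points of [B] apart,
    and their lifts meet neither [x] nor [y]. *)
Lemma card_glued_sa : (#|sa_set W' B :\: touching W' B fibre| +
  #|touching W J [set x; y]| <= #|sa_set W J|)%N.
Proof.
have [phi Hphi] : exists phi : I * I -> I * I, forall q, q \in sa_set W' B ->
    [/\ phi q \in sa_set W J, identified p W' (phi q).1 q.1 &
        identified p W' (phi q).2 q.2].
  suff /choice[phi Hphi] : forall q, exists r, q \in sa_set W' B ->
      [/\ r \in sa_set W J, identified p W' r.1 q.1 & identified p W' r.2 q.2].
    by exists phi.
  move=> q; have [/sa_setP sq|] := boolP (q \in sa_set W' B); last by exists q.
  have [u [v [suv uq vq _]]] := sa_pair_lift pos glue_sub BJ dom J1 sq (mem0v W).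
  by exists (u, v) => _; split=> //; apply/sa_setP.
have sub_sa : touching W J [set x; y] \subset sa_set W J.
  by apply/fintype.subsetP => q; rewrite inE => /andP[].
set E := _ :\: _; have EP q : q \in E -> [/\ q \in sa_set W' B, q.1 \in B, q.2 \in B,
    ~ identified p W' q.1 x & ~ identified p W' q.2 x].
  rewrite finset.in_setD => /andP[+ sq]; have /sa_setP[q1 q2 _ _] := sq.
  rewrite inE sq /= negb_or => /andP[n1 n2].
  by split=> // qx; [move/negP: n1|move/negP: n2]; apply; apply/fibreP.
have <- : #|[set phi q | q in E]| = #|E|.
  apply: card_in_imset => q r /EP[qS q1 q2 _ _] /EP[rS r1 r2 _ _] qr.
  have [_ a1 a2] := Hphi q qS; have [_ b1 b2] := Hphi r rS.
  have e1 : q.1 = r.1.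
    by apply: (vertex_identified posB) => // g gW; rewrite -a1 // -b1 // qr.
  have e2 : q.2 = r.2.
    by apply: (vertex_identified posB) => // g gW; rewrite -a2 // -b2 // qr.
  by case: q e1 e2 {qr qS q1 q2 a1 a2} => ? ?; case: r {rS r1 r2 b1 b2} => ? ? /= -> ->.
have dis : [disjoint [set phi q | q in E] & touching W J [set x; y]].
  apply/pred0P => r /=; apply/negP => /andP[/imsetP[q /EP[qS _ _ n1 n2] ->]].
  have [_ a1 a2] := Hphi q qS; rewrite inE => /andP[_ /orP[]];
    rewrite !inE => /orP[] /eqP E0.
  - by apply: n1 => g gW; rewrite -a1 // E0.
  - by apply: n1 => g gW; rewrite -a1 // E0 yx_identified.
  - by apply: n2 => g gW; rewrite -a2 // E0.
  - by apply: n2 => g gW; rewrite -a2 // E0 yx_identified.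
have := leq_card_setU [set phi q | q in E] (touching W J [set x; y]).
rewrite dis => -[_ /eqP<-]; rewrite subset_leq_card // finset.subUset sub_sa andbT.
by apply/fintype.subsetP => r /imsetP[q /EP[qS _ _ _ _] ->]; case: (Hphi q qS).
Qed.

Lemma fibre_eq k l : k \in fibre -> l \in fibre -> k = l.
Proof.
move=> /fibreP[kB kx] /fibreP[lB lx].
by apply: (vertex_identified posB) => // g gW; rewrite kx // lx.
Qed.

(** A functional exposing a point of the fibre in [B] would witness [is_edge]. *)
Lemma fibre_non_edge : ~ is_edge p W J x y -> fibre = finset.set0.
Proof.
move=> nedge; apply/eqP; apply: contra_notT nedge => /set0Pn[k /fibreP[kB kx]].
have [f fW' fk] := posB.2 k kB; exists f => // i iJ.
rewrite -kx //; have [|ki] := ltP (ev f i) (ev f k); first by left.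
right=> g gW'; rewrite -kx //.
exact: (max_identified dom fW' kB fk iJ ki).
Qed.

(** Breaking ties by a functional that exposes [z] lifts the neighbours of [k] to neighbours of [z]
    itself. The other endpoint is a neighbour of [z] that no lift reaches, hence the strict
    inequality. *)
Lemma fibre_degree k z : sa_pair p W J x y -> k \in fibre -> z \in [set x; y] ->
  (#|nbrs W' B k| < #|nbrs W J z|)%N.
Proof.
move=> sa /fibreP[kB kx] zxy.
have zJ : z \in J by move: zxy; rewrite !inE => /orP[] /eqP->.
have zx : identified p W' z x by move: zxy; rewrite !inE => /orP[] /eqP->.
have [z' [z'N z'x]] : exists z', z' \in nbrs W J z /\ identified p W' z' x.
  move: zxy; rewrite !inE => /orP[] /eqP->; first by exists y; split=> //; apply/nbrsP.
  by exists x; split=> //; apply/nbrsP/sa_pair_sym.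
have [g gW gz] := pos.2 z zJ.
have [phi Hphi] : exists phi : I -> I, forall q, q \in nbrs W' B k ->
    phi q \in nbrs W J z /\ identified p W' (phi q) q.
  suff /choice[phi Hphi] : forall q, exists v, q \in nbrs W' B k ->
      v \in nbrs W J z /\ identified p W' v q by exists phi.
  move=> q; have [/nbrsP sq|] := boolP (q \in nbrs W' B k); last by exists q.
  have [u [v [suv uk vq gu]]] := sa_pair_lift pos glue_sub BJ dom J1 sq gW.
  exists v => _; split=> //; apply/nbrsP; suff <- : u = z by [].
  have [uJ _ _ _] := suv; apply/eqP; apply/negPn/negP => /(gz u uJ).
  by apply/negP; rewrite -leNgt gu // => g' g'W; rewrite zx // kx.
have <- : #|[set phi q | q in nbrs W' B k]| = #|nbrs W' B k|.
  apply: card_in_imset => q r qN rN qr; have [_ a] := Hphi q qN.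
  have [_ b] := Hphi r rN; have /nbrsP[_ qB _ _] := qN; have /nbrsP[_ rB _ _] := rN.
  by apply: (vertex_identified posB) => // g' g'W; rewrite -a // -b // qr.
rewrite (cardsD1 z' (nbrs W J z)) z'N add1n ltnS subset_leq_card //.
apply/fintype.subsetP => _ /imsetP[q qN ->]; have [a b] := Hphi q qN.
rewrite in_setD1 a andbT; apply: contraTneq qN => qz'; apply/negP => qN.
have /nbrsP[_ qB kq _] := qN; case/eqP: kq.
by apply: (vertex_identified posB) => // g' g'W; rewrite kx // -b // qz' z'x.
Qed.

Lemma card_touching_fibre k : k \in fibre ->
  (#|touching W' B fibre| <= 2 * #|nbrs W' B k|)%N.
Proof.
move=> kF; pose L := [seq (k, v) | v <- enum (nbrs W' B k)] ++
  [seq (v, k) | v <- enum (nbrs W' B k)].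
have -> : (2 * #|nbrs W' B k|)%N = size L.
  by rewrite size_cat !size_map -cardE addnn mul2n.
rewrite cardE; apply: uniq_leq_size; first exact: enum_uniq.
move=> [q1 q2]; rewrite mem_enum inE mem_sa_set mem_cat => /andP[qN /= /orP[] qF].
  have <- := fibre_eq qF kF; apply/orP; left; apply/mapP; exists q2 => //.
  by rewrite mem_enum.
have <- := fibre_eq qF kF; apply/orP; right; apply/mapP; exists q1 => //.
by rewrite mem_enum -nbrs_sym in qN *.
Qed.

End Gluing.

Lemma ex_sa_pair W J x : vertex_position W J -> (1 < #|J|)%N -> x \in J ->
  exists y, sa_pair p W J x y.
Proof.
move=> pos J1 xJ; have [f fW fx] := pos.2 x xJ.
have [u [v [suv lex]]] := lex_sa_pair pos J1 fW fW; have [uJ vJ _ _] := suv.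
exists v; suff <- : u = x by [].
apply/eqP; apply/negPn/negP => /(fx u uJ); apply/negP; rewrite -leNgt.
by case: (lex x xJ).
Qed.

Lemma card_sa_set_of_edges W J : vertex_position W J -> (1 < \dim W)%N ->
  #|J| = (2 * \dim W - 1)%N ->
  (forall x y, sa_pair p W J x y -> is_edge p W J x y) ->
  (6 * (\dim W - 1) <= #|sa_set W J|)%N.
Proof.
move=> pos d2 cJ edges; have J1 : (1 < #|J|)%N by rewrite cJ; move: d2; clear; lia.
have deg2 x : x \in J -> (2 <= #|nbrs W J x|)%N.
  move=> xJ; have [y sxy] := ex_sa_pair pos J1 xJ.
  exact: edge_degree_ge2 pos d2 sxy (edges x y sxy).
rewrite card_sa_set.
have [[x [xJ x3]]|no] := pselect (exists x, x \in J /\ (#|nbrs W J x| < 3)%N); last first.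
  apply: leq_trans (_ : \sum_(x in J) 3 <= _)%N.
    by rewrite sum_nat_const cJ; move: d2; clear; lia.
  by apply: leq_sum => x xJ; rewrite leqNgt; apply/negP => x3; apply: no; exists x.
have /card_gt1P[y [z [yN zN yz]]] := deg2 x xJ.
have deg_nbr v : v \in nbrs W J x -> v \in J /\ (\dim W <= #|nbrs W J v|)%N.
  move=> /nbrsP sxv; have [_ vJ _ _] := sxv; split=> //.
  have := edge_degree_sum pos d2 sxv (edges _ _ sxv).
  by move: x3; clear; lia.
have [yJ dy] := deg_nbr y yN; have [zJ dz] := deg_nbr z zN.
(* The two neighbours contribute at least [2 * \dim W], the other [2 * \dim W - 3] points at least 2
   each. *)
rewrite (bigD1 y) //= (bigD1 z) /=; last by rewrite zJ eq_sym.
have : (\sum_(i in J :\ y :\ z) 2 <= \sum_(i | (i \in J) && (i != y) && (i != z)) #|nbrs W J i|)%N.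
  rewrite (eq_bigl (fun i => (i \in J) && (i != y) && (i != z))).
    by apply: leq_sum => i /andP[/andP[iJ _] _]; exact: deg2.
  by move=> i; rewrite !in_setD1; case: (i \in J); case: (i != y); case: (i != z).
rewrite sum_nat_const.
have := cardsD1 y J; have := cardsD1 z (J :\ y); rewrite in_setD1 zJ eq_sym yz yJ cJ.
set S := (\sum_(i | _) _)%N; move: d2 dy dz; clear; lia.
Qed.

Theorem card_sa_set_ge W J : vertex_position W J -> (#|J| < 2 * \dim W)%N ->
  (6 * (\dim W - 1) <= #|sa_set W J|)%N.
Proof.
move dE : (\dim W) => m; elim: m => [|m IHm] in W J dE *; first by [].
move=> pos cJ; have [->//|m0] := posnP m.
have d2 : (1 < \dim W)%N by rewrite dE.
have glue_bound x y : sa_pair p W J x y -> exists B,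
    [/\ B \subset J, dominates p (glue W x y) B J, vertex_position (glue W x y) B &
      (#|B| < 2 * m -> 6 * (m - 1) <= #|sa_set (glue W x y) B|)%N].
  move=> [xJ yJ xy [c cW Hc]].
  have [B [BJ dom vert]] := minimal_dominating p (glue W x y) J.
  have posB : vertex_position (glue W x y) B.
    apply: (dominating_position pos _ dom) vert.
      by apply/subvP => g /mem_annih[].
    by apply/card_gt0P; exists x.
  exists B; split=> //; apply: IHm posB.
  apply: succn_inj; rewrite -dE; apply: (@dim_annih1 _ _ _ _ c) => //.
  by rewrite dotBr subr_eq0 gt_eqF //; apply: (Hc y yJ).1; rewrite eq_sym.
(* For a non-edge both endpoints leave, and with them at least [2 * 4 - 2 = 6] ordered pairs. *)
have [[x [y [sa nedge]]]|alledge] :=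
    pselect (exists x y, sa_pair p W J x y /\ ~ is_edge p W J x y).
  have [xJ yJ xy _] := sa.
  have [B [BJ dom posB IH]] := glue_bound x y sa.
  have F0 := fibre_non_edge dom posB nedge.
  have notB k : identified p (glue W x y) k x -> k \notin B.
    move=> kx; apply/negP => kB; have : k \in fibre W B x y by apply/fibreP.
    by rewrite F0 inE.
  have yxI : identified p (glue W x y) y x by move=> g /mem_annih_diff[].
  have cB : (#|B| + 2 <= #|J|)%N.
    rewrite (cardsD1 x J) xJ (cardsD1 y (J :\ x)) in_setD1 eq_sym xy yJ.
    have : (#|B| <= #|J :\ x :\ y|)%N.
      apply/subset_leq_card/fintype.subsetP => k kB; rewrite !in_setD1.
      rewrite (fintype.subsetP BJ) // andbT; apply/andP.
      by split; apply: contraTneq kB => ->; apply: notB.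
    by clear; lia.
  have := IH ltac:(move: cB cJ m0; clear; lia).
  have := card_glued_sa pos xJ yJ xy BJ dom posB.
  have -> : touching (glue W x y) B (fibre W B x y) = finset.set0.
    by apply/finset.setP => q; rewrite F0 !inE andbF.
  rewrite finset.setD0; have := card_touching_edge sa.
  have := degree_sum_ge4 pos d2 _ sa; rewrite dE => /(_ cJ).
  by move: m0; clear; lia.
have edges x y : sa_pair p W J x y -> is_edge p W J x y.
  by move=> sa; apply: contrapT => nedge; apply: alledge; exists x, y.
(* Together with [cJ], [full] means that [J] has exactly [2 * \dim W - 1] points. *)
have [full|small] := leqP (2 * m).+1 #|J|.
  by have := card_sa_set_of_edges pos d2; rewrite dE; apply=> //; move: full cJ; clear; lia.
have [x0 x0J] : exists x0, x0 \in J.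
  apply/card_gt0P; rewrite lt0n; apply: contraTneq d2 => /eqP.
  rewrite cards_eq0 => /eqP J0; rewrite -leqNgt leqNgt; apply/negP => d2.
  have [|f fW f0] := @annih_neq0 _ _ W [::]; first exact: ltn_trans d2.
  by case/eqP: f0; apply: pos.1 => // i; rewrite J0 inE.
have [w [wJ wx0 _]] := third_point pos d2 x0J x0J.
have J1 : (1 < #|J|)%N by apply/card_gt1P; exists w, x0.
have [y sa] := ex_sa_pair pos J1 x0J; have [xJ yJ xy _] := sa.
have [z [zJ zx zy]] := third_point pos d2 x0J yJ.
(* [m = 1] would leave room for two points only. For [1 < m] the degree sum over an edge is at least
   5, so one endpoint has degree at least 3. *)
have m2 : (1 < m)%N.
  have : (2 < #|J|)%N by apply/card_gt2P; exists x0, y, z; rewrite [y == z]eq_sym.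
  by move: small; clear; lia.
have [B [BJ dom posB IH]] := glue_bound x0 y sa.
have yxI : identified p (glue W x0 y) y x0 by move=> g /mem_annih_diff[].
have cB : (#|B| < #|J|)%N.
  apply: proper_card; rewrite properE BJ; apply/negP => JB.
  case/eqP: xy; symmetry; apply: (vertex_identified posB) => //;
  exact: (fintype.subsetP JB).
have := IH (leq_trans cB small).
have := card_glued_sa pos xJ yJ xy BJ dom posB; have := card_touching_edge sa.
have := edge_degree_sum pos d2 sa (edges _ _ sa); rewrite dE.
rewrite cardsD (_ : _ :&: _ = touching (glue W x0 y) B (fibre W B x0 y)); last first.
  by apply/finset.setIidPr/fintype.subsetP => q; rewrite inE => /andP[].
have [F0|[k kF]] := set_0Vmem (fibre W B x0 y).
  have -> : touching (glue W x0 y) B (fibre W B x0 y) = finset.set0.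
    by apply/finset.setP => q; rewrite F0 !inE andbF.
  by rewrite cards0; move: m2; clear; lia.
(* With endpoint degrees [a] and [b], the loss is at least [2 * (a + b) - 2 - 2 * (min a b - 1) = 2
   * max a b], which is at least 6. *)
have := card_touching_fibre posB kF.
have := fibre_degree pos xJ yJ xy BJ dom posB sa kF (set21 x0 y).
have := fibre_degree pos xJ yJ xy BJ dom posB sa kF (set22 x0 y).
by move: m2; clear; lia.
Qed.

End Counting.

Local Open Scope classical_set_scope.

(** * From supporting hyperplanes to functionals *)

Section PointSets.
Variables (R : realType) (d : nat).
Implicit Types (a f v x y z : 'rV[R]_d) (b t : R) (X : {fset 'rV[R]_d}).

Lemma convex_setI (A : set 'rV[R]_d) :
  (forall x y t, A x -> A y -> 0 <= t <= 1 -> A (t *: x + (1 - t) *: y)) ->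
  convex_set A.
Proof.
move=> H x y t /set_mem xA /set_mem yA; apply/mem_set.
by apply: (H x y t%:num) => //; apply/andP; split.
Qed.

Lemma dot_segment a x y t :
  dot a (t *: x + (1 - t) *: y) = t * dot a x + (1 - t) * dot a y.
Proof. by rewrite dotDr !dotZr. Qed.

Lemma sub_conv X x : x \in X -> Defs.conv X x.
Proof. by move=> xX; apply: (@sub_smallest _ _ _ [set` X]). Qed.

Lemma conv_le X a b : (forall x, x \in X -> dot a x <= b) ->
  forall z, Defs.conv X z -> dot a z <= b.
Proof.
move=> Xb; apply: smallest_sub Xb; apply: convex_setI => x y t /= xb yb /andP[t0 t1].
rewrite dot_segment.
have : 0 <= t * (b - dot a x) by rewrite mulr_ge0 // subr_ge0.
have : 0 <= (1 - t) * (b - dot a y) by rewrite mulr_ge0 // subr_ge0.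
lra.
Qed.

Lemma conv_lt X a b : (forall x, x \in X -> dot a x < b) ->
  forall z, Defs.conv X z -> dot a z < b.
Proof.
move=> Xb; apply: smallest_sub Xb; apply: convex_setI => x y t /= xb yb /andP[t0 t1].
rewrite dot_segment; have [->|tn0] := eqVneq t 0; first by lra.
have : 0 < t * (b - dot a x) by rewrite mulr_gt0 ?subr_gt0 // lt_neqAle eq_sym tn0.
have : 0 <= (1 - t) * (b - dot a y) by rewrite mulr_ge0 ?subr_ge0 // ltW.
lra.
Qed.

(** The point [x] together with the open half-space below it is convex. *)
Lemma conv_unique_max X a x :
  (forall z, z \in X -> z != x -> dot a z < dot a x) ->
  forall z, Defs.conv X z -> z = x \/ dot a z < dot a x.
Proof.
move=> Xx; apply: smallest_sub => [|z zX] /=.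
  apply: convex_setI => y z t /= yx zx /andP[t0 t1]; rewrite dot_segment.
  have [->|tn0] := eqVneq t 0; first by rewrite scale0r add0r subr0 scale1r mul0r add0r mul1r.
  have [->|tn1] := eqVneq t 1; first by rewrite subrr scale0r addr0 scale1r mul0r addr0 mul1r.
  have {tn0}t0 : 0 < t by rewrite lt_neqAle eq_sym tn0.
  have {tn1}t1 : 0 < 1 - t by rewrite subr_gt0 lt_neqAle tn1.
  have H w s : 0 < s -> w = x \/ dot a w < dot a x ->
      w = x \/ s * dot a w < s * dot a x.
    by move=> s0 [|lt]; [left|right; rewrite ltr_pM2l].
  case: (H y t t0 yx) => [->|lt1]; case: (H z (1 - t) t1 zx) => [->|lt2].
  - by left; rewrite -scalerDl addrC subrK scale1r.
  - by right; lra.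
  - by right; lra.
  - by right; lra.
by have [->|zx] := eqVneq z x; [left|right; exact: Xx].
Qed.

(** For the converse inclusion, a hyperplane exposing a vertex of the hull contains a point of [X],
    since otherwise the whole hull would lie strictly on one side. *)
Lemma exposed_strictly_convex X : (forall x, x \in X -> exists2 a, a != 0 &
    forall z, z \in X -> z != x -> dot a z < dot a x) ->
  strictly_convex_position X.
Proof.
move=> Xvert; apply/seteqP; split=> [x xX|v].
  have [a a0 ax] := Xvert x xX; have unique := conv_unique_max ax.
  exists (hyperplane a (dot a x)).
    exists a, (dot a x); split=> //; last by exists x; split=> //; exact: sub_conv.
    by move=> z /unique[->|/ltW].
  apply/seteqP; split=> [z [/unique[//|lt] /= e]|_ ->]; first by rewrite e ltxx in lt.
  by split=> //; exact: sub_conv.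
move=> [H [a [b [a0 -> Pb _]]] PH].
have [[x [xX xb]]|no] := pselect (exists x, x \in X /\ dot a x = b).
  suff : [set v] x by move=> /= <-.
  by rewrite -PH; split=> //; exact: sub_conv.
have : (Defs.conv X `&` hyperplane a b) v by rewrite PH.
move=> [vX /= vb]; suff /(_ v vX) : forall z, Defs.conv X z -> dot a z < b.
  by rewrite vb ltxx.
apply: conv_lt => x xX; rewrite lt_neqAle Pb ?andbT; last exact: sub_conv.
by apply/eqP => xb; apply: no; exists x.
Qed.

Lemma exposed_vertex X x : strictly_convex_position X -> x \in X ->
  exists a, forall z, z \in X -> z != x -> dot a z < dot a x.
Proof.
move=> Xvert xX; have : vert (Defs.conv X) x by rewrite -Xvert.
move=> [H [a [b [a0 -> Pb _]]] PH]; exists a => z zX zx.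
have [_ xb] : (Defs.conv X `&` hyperplane a b) x by rewrite PH.
rewrite (_ : dot a x = b) // lt_neqAle Pb ?andbT; last exact: sub_conv.
apply: contra zx => /eqP zb; apply/eqP.
suff : [set x] z by [].
by rewrite -PH; split=> //; exact: sub_conv.
Qed.

Lemma aff_separates X a : aff X = setT ->
  (forall x y, x \in X -> y \in X -> dot a x = dot a y) -> a = 0.
Proof.
move=> affX Xa.
have affE y : exists w : 'rV[R]_d -> R,
    \sum_(x <- X) w x = 1 /\ y = \sum_(x <- X) w x *: x.
  have : aff X y by rewrite affX.
  by [].
have [x0 x0X] : exists x0, x0 \in X.
  have [X0|[x0 x0X]] := fset_0Vmem X; last by exists x0.
  have [w [/eqP]] := affE 0; rewrite X0 big_seq_fset0 eq_sym oner_eq0 //.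
have dotE y : dot a y = dot a x0.
  have [w [w1 ->]] := affE y.
  rewrite (big_morph (dot a) (dotDr a) (id1 := 0)); last by rewrite dotC dot0l.
  rewrite -[RHS]mul1r -w1 mulr_suml [LHS]big_seq [RHS]big_seq.
  by apply: eq_bigr => x xX; rewrite dotZr (Xa x x0).
by apply: dot_self_eq0; rewrite dotE -(dotE 0) dotC dot0l.
Qed.

Lemma hyperplane_translate a b v :
  [set x + v | x in hyperplane a b] = hyperplane a (b + dot a v).
Proof.
apply/seteqP; split=> [_ [x /= xb <-]|x /= xb]; first by rewrite /hyperplane /= dotDr xb.
by exists (x - v); rewrite /hyperplane /= ?subrK // dotBr xb addrK.
Qed.

(** Distinct parallel supporting hyperplanes have proportional normals and bound the hull from
    opposite sides, so a single functional is extremal on both. *)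
Lemma strictly_antipodalP X x y : strictly_antipodal X x y <->
  [/\ x \in X, y \in X, x != y & exists f, forall z, z \in X ->
        (z != x -> dot f z < dot f x) /\ (z != y -> dot f y < dot f z)].
Proof.
split=> [[xX yX xy antipodal]|[xX yX xy [f Hf]]]; split=> //; last first.
  have fyx : dot f y < dot f x by apply: (Hf y yX).1; rewrite eq_sym.
  have f0 : f != 0 by apply: contraTneq fyx => ->; rewrite !dot0l ltxx.
  exists (hyperplane f (dot f x)), (hyperplane f (dot f y)); split.
  - split; first exists f, (dot f x); last exists (- f), (- dot f y).
      split=> //; last by exists x; split=> //; exact: sub_conv.
      apply: conv_le => z zX; have [->//|zx] := eqVneq z x.
      exact/ltW/(Hf z zX).1.
    split; rewrite ?oppr_eq0 //; last by exists y; split=> //; exact: sub_conv.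
      by apply/seteqP; split=> z; rewrite /hyperplane /= dotNl; [move=> ->|move/oppr_inj].
    apply: conv_le => z zX; rewrite dotNl lerN2; have [->//|zy] := eqVneq z y.
    exact/ltW/(Hf z zX).2.
  - exists (y - x); rewrite hyperplane_translate; congr hyperplane.
    by rewrite dotBr; lra.
  - move=> E; have : hyperplane f (dot f y) x by rewrite -E.
    by rewrite /hyperplane /= => e; rewrite e ltxx in fyx.
  - apply/seteqP; split=> [z [/= zX zx]|_ ->] //.
    by apply/eqP/negPn/negP => /(Hf z zX).1; rewrite zx ltxx.
  - apply/seteqP; split=> [z [/= zX zy]|_ ->] //.
    by apply/eqP/negPn/negP => /(Hf z zX).2; rewrite zy ltxx.
have [H' [H'' [[[a [b [a0 -> Pb _]]] [a' [b' [a'0 H''E Pb' _]]]] [v vE] ne Xx Xy]]] := antipodal.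
have ax : dot a x = b by have [] : ([set` X] `&` hyperplane a b) x by rewrite Xx.
have H''a : H'' = hyperplane a (b + dot a v) by rewrite vE hyperplane_translate.
have ay : dot a y = b + dot a v.
  have [] : ([set` X] `&` H'') y by rewrite Xy.
  by rewrite H''a.
have a'y : dot a' y = b'.
  have [] : ([set` X] `&` H'') y by rewrite Xy.
  by rewrite H''E.
have xy_lt : dot a y < dot a x.
  rewrite lt_neqAle ax Pb ?andbT; last exact: sub_conv.
  by apply/eqP => e; apply: ne; rewrite H''a -ay e.
(* [a'] vanishes on the kernel of [a], so it is a multiple of [a]. *)
pose u := dot a x - dot a y; have u0 : 0 < u by rewrite subr_gt0.
have a'E z : u * (dot a' z - b') = (dot a' x - b') * (dot a z - dot a y).
  pose s := (dot a z - dot a y) / u.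
  have : H'' (z - s *: (x - y)).
    rewrite H''a /hyperplane /= dotBr dotZr dotBr -ay divfK ?gt_eqF //; lra.
  rewrite H''E /hyperplane /= dotBr dotZr dotBr a'y => e.
  have -> : dot a z - dot a y = s * u by rewrite divfK ?gt_eqF.
  have -> : dot a' z - b' = s * (dot a' x - b') by lra.
  by ring.
exists a => z zX; split=> zn.
  rewrite ax lt_neqAle Pb ?andbT; last exact: sub_conv.
  apply: contra zn => /eqP zb; apply/eqP; suff : [set x] z by [].
  by rewrite -Xx.
have a'zb : dot a' z < b'.
  rewrite lt_neqAle Pb' ?andbT; last exact: sub_conv.
  apply: contra zn => /eqP zb; apply/eqP; suff : [set y] z by [].
  by rewrite -Xy; split=> //; rewrite H''E.
(* The normals point in opposite directions, which turns the upper bound on [a'] into a lower bound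
   on [a]. *)
have a'xb : dot a' x - b' <= 0 by rewrite subr_le0 Pb' //; exact: sub_conv.
have := a'E z; have : u * (dot a' z - b') < 0 by rewrite pmulr_rlt0 // subr_lt0.
move=> lt0 e; rewrite e in lt0; rewrite -subr_gt0 ltNge; apply/negP => le0.
by have := mulr_le0 a'xb le0; lra.
Qed.

(** The ordered pairs of increasing rank and their swaps cover [sa_set], and the former inject into
    the unordered pairs. *)
Lemma card_sa_set_le_sa X :
  (#|sa_set (fun i : X => val i) fullv [set: X]%SET| <= 2 * sa X)%N.
Proof.
set p := fun i : X => val i; set E := sa_set _ _ _.
pose S1 := [set q in E | (enum_rank q.1 < enum_rank q.2)%N]%SET.
pose swap (q : X * X) := (q.2, q.1).
have swapK : cancel swap swap by case.
have saP q : q \in E -> strictly_antipodal X (val q.1) (val q.2).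
  move=> /sa_setP[_ _ q12 [f _ Hf]]; apply/strictly_antipodalP.
  split; [exact: valP|exact: valP|by []|exists f => z zX].
  have := Hf [` zX]%fset; rewrite inE => /(_ isT)[H1 H2].
  by split=> zq; [apply: H1|apply: H2]; apply: contra zq => /eqP<-.
have E_cover : E \subset S1 :|: swap @: S1.
  apply/fintype.subsetP => -[q1 q2] qE; rewrite inE.
  have /sa_setP[_ _ /= q12 _] := qE.
  case: (ltngtP (enum_rank q1) (enum_rank q2)) => [lt|gt|eq].
  - by rewrite inE qE /= lt.
  - apply/orP; right; apply/imsetP; exists (q2, q1) => //.
    by rewrite inE /= gt andbT; move: qE => /sa_setP/sa_pair_sym ?; apply/sa_setP.
  - by case/eqP: q12; apply/enum_rank_inj/val_inj.
apply: leq_trans (subset_leq_card E_cover) _.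
apply: leq_trans (leq_card_setU _ _) _; rewrite card_imset; last exact: can_inj swapK.
rewrite addnn -mul2n leq_mul2l /=.
pose Y (q : X * X) := [fset val q.1; val q.2]%fset.
have Y_inj : {in S1 &, injective Y}.
  move=> [q1 q2] [r1 r2]; rewrite !inE /= => /andP[_ q12] /andP[_ r12] /fsetP Eqr.
  have := Eqr (val q1); have := Eqr (val q2); have := Eqr (val r1).
  rewrite !in_fset2 !eqxx ?orbT !(inj_eq val_inj) /=.
  move=> H1 /esym/orP[]/eqP E2 /esym/orP[]/eqP E1; subst => //.
  - by rewrite ltnn in q12.
  - by have := ltn_trans q12 r12; rewrite ltnn.
  - by rewrite ltnn in q12.
rewrite cardE -(size_map Y) /sa; apply: uniq_leq_size.
  rewrite map_inj_in_uniq ?enum_uniq // => q r; rewrite !mem_enum; exact: Y_inj.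
move=> _ /mapP[q qS ->]; move: qS; rewrite mem_enum inE => /andP[qE _].
rewrite !inE fpowersetE fsubUset !fsub1set !(valP q.1) !(valP q.2) /=.
by apply/asboolP; exists (val q.1), (val q.2); split=> //; exact: saP.
Qed.

End PointSets.

Lemma sa_ge (R : realType) (d k : nat) (X : {fset 'rV[R]_d}) : (k <= d - 1)%N ->
  (1 < d)%N -> Cs (d + k) X -> (3 * (d - 1) <= sa X)%N.
Proof.
move=> kd d1 [cX affX convX].
pose p := fun i : X => val i.
have dimW : \dim {: 'rV[R]_d} = d by rewrite dimvf; exact: etrans (dim_matrix _ _ _) (mul1n d).
have pos : vertex_position p fullv [set: X]%SET.
  split=> [f _ fX|j _].
    apply: (aff_separates affX) => x y xX yX.
    by apply: (fX [` xX]%fset [` yX]%fset); rewrite inE.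
  have [a aj] := exposed_vertex convX (valP j); exists a; first exact: memvf.
  by move=> i _ ij; apply: aj; [exact: valP|rewrite (inj_eq val_inj)].
have := card_sa_set_ge pos; rewrite dimW cardsT -cardfE cX.
have lt : (d + k < 2 * d)%N by move: kd d1; clear; lia.
by move=> /(_ lt) H; have := leq_trans H (card_sa_set_le_sa X); clear; lia.
Qed.

(** * The extremal example *)

(* The basis vectors [e_i] and the opposites of the first [k] of them; for
   [k = d - 1] this is a pyramid over a cross-polytope. *)
Section PartialCrossPolytope.
Variables (R : realType) (d k : nat).
Hypothesis kd : (k <= d)%N.

Definition cross_point (t : ('I_d + 'I_k)%type) : 'rV[R]_d :=
  match t with
  | inl i => delta_mx 0 i
  | inr j => - delta_mx 0 (widen_ord kd j)
  end.

Definition cross_set : {fset 'rV[R]_d} := [fset cross_point t | t in {: ('I_d + 'I_k)%type}]%fset.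

Lemma dot_delta (a : 'rV[R]_d) i : dot a (delta_mx 0 i) = a 0 i.
Proof.
rewrite /dot (bigD1 i) //= mxE !eqxx mulr1 big1 ?addr0 // => j ji.
by rewrite mxE (negPf ji) andbF mulr0.
Qed.

Lemma cross_point_exposed t : exists2 a, a != 0 & forall t', t' != t ->
  dot a (cross_point t') < dot a (cross_point t).
Proof.
have delta0 i : delta_mx 0 i != 0 :> 'rV[R]_d.
  by apply/eqP => /rowP/(_ i)/eqP; rewrite !mxE !eqxx oner_eq0.
case: t => [i|j].
  exists (delta_mx 0 i) => //= -[i'|j'] ti; rewrite /= ?dotNr !dot_delta !mxE !eqxx /=.
    by rewrite (_ : (i' == i) = false) ?ltr01 //; apply: contraNF ti => /eqP->.
  by rewrite (le_lt_trans _ ltr01) // oppr_le0 ler0n.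
exists (- delta_mx 0 (widen_ord kd j)); rewrite ?oppr_eq0 //= => -[i'|j'] tj;
  rewrite /= !dotNl ?dotNr ?opprK !dot_delta !mxE !eqxx /=.
  by rewrite (le_lt_trans _ ltr01) // oppr_le0 ler0n.
rewrite (_ : (widen_ord kd j' == widen_ord kd j) = false) ?ltr01 //.
by apply: contraNF tj => /eqP[jj]; apply/eqP; congr inr; apply: val_inj.
Qed.

Lemma cross_point_inj : injective cross_point.
Proof.
move=> t t' E; apply/eqP; apply/negPn/negP => ne.
by have [a _ /(_ _ ne)] := cross_point_exposed t'; rewrite E ltxx.
Qed.

Lemma cross_setP x : reflect (exists t, x = cross_point t) (x \in cross_set).
Proof. by apply: (iffP (imfsetP _ _ _ _)) => [[t _ ->]|[t ->]]; exists t. Qed.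

Lemma aff_cross_set : (0 < k)%N -> aff cross_set = setT.
Proof.
move=> k0; apply/seteqP; split=> // y _.
pose j0 := Ordinal k0; pose i0 := widen_ord kd j0.
(* Half of what the coordinates of [y] lack to sum to 1. Added to the weights of a basis vector and
   of its opposite, it corrects the total without moving the point. *)
pose s := (1 - \sum_i y 0 i) / 2.
pose c (t : ('I_d + 'I_k)%type) : R := match t with
  | inl i => y 0 i + (if i == i0 then s else 0)
  | inr j => if j == j0 then s else 0
  end.
pose w (x : 'rV[R]_d) : R := if [pick t | cross_point t == x] is Some t then c t else 0.
have wE t : w (cross_point t) = c t.
  rewrite /w; case: pickP => [t' /eqP/cross_point_inj->//|/(_ t)].
  by rewrite eqxx.
have sum_s (V : nmodType) n (m : 'I_n) (v : V) : \sum_i (if i == m then v else 0) = v.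
  by rewrite -big_mkcond big_pred1_eq.
exists w; split.
  rewrite big_imfset /=; last by move=> ? ? _ _; exact: cross_point_inj.
  under eq_bigr do rewrite wE.
  rewrite big_enum big_sumType /= big_split /= !sum_s /s; lra.
rewrite big_imfset /=; last by move=> ? ? _ _; exact: cross_point_inj.
under eq_bigr do rewrite wE.
rewrite big_enum big_sumType /=.
under eq_bigr do rewrite scalerDl.
rewrite big_split /= -row_sum_delta -[LHS]addr0 -addrA; congr (_ + _).
have -> : \sum_(i < d) (if i == i0 then s else 0) *: (delta_mx 0 i : 'rV[R]_d) =
          s *: delta_mx 0 i0.
  rewrite -[RHS](sum_s _ _ i0); apply: eq_bigr => i _.
  by case: eqP => [->//|_]; rewrite scale0r.
have -> : \sum_(j < k) (if j == j0 then s else 0) *: - (delta_mx 0 (widen_ord kd j) : 'rV[R]_d) =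
          - (s *: delta_mx 0 i0).
  rewrite -[RHS](sum_s _ _ j0); apply: eq_bigr => i _.
  by case: eqP => [->|_]; rewrite ?scalerN // scale0r oppr0.
by rewrite subrr.
Qed.

Lemma cross_set_Cs : (0 < k)%N -> Cs (d + k) cross_set.
Proof.
move=> k0; split; last 2 first.
- exact: aff_cross_set.
- apply: exposed_strictly_convex => _ /cross_setP[t ->].
  have [a a0 at_] := cross_point_exposed t; exists a => // _ /cross_setP[t' ->].
  by move=> ne; apply: at_; apply: contra ne => /eqP->.
by rewrite card_imfset /=; [rewrite -cardT card_sum !card_ord|exact: cross_point_inj].
Qed.

End PartialCrossPolytope.

(** Otherwise [- x] lies strictly above the minimum at [y] and [- y] strictly below the maximum at
    [x], giving [dot f x + dot f y] two opposite signs. *)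
Lemma antipodal_symmetric (R : realType) (d : nat) (X : {fset 'rV[R]_d}) x y :
  - x \in X -> - y \in X -> strictly_antipodal X x y -> y = - x.
Proof.
move=> NxX NyX /strictly_antipodalP[xX yX xy [f Hf]].
apply/eqP; apply/negPn/negP => yNx.
have /(Hf _ NxX).2 : - x != y by rewrite eq_sym.
have /(Hf _ NyX).1 : - y != x by apply: contra yNx => /eqP<-; rewrite opprK.
by rewrite !dotNr; lra.
Qed.

(** [L] lists the candidates: [m] opposite pairs, and the apex [e ord_max] with each of the [2 * m]
    base points. By [antipodal_symmetric], pairs inside the base are opposite. *)
Lemma sa_cross_set (R : realType) (m : nat) :
  (sa (cross_set R (leqnSn m)) <= 3 * m)%N.
Proof.
set X := cross_set _ _; pose le := leqnSn m.
pose e (i : 'I_m.+1) : 'rV[R]_m.+1 := delta_mx 0 i.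
pose w (j : 'I_m) : 'I_m.+1 := widen_ord le j.
pose L := [seq [fset e (w j); - e (w j)]%fset | j <- enum 'I_m] ++
  [seq [fset e ord_max; e (w j)]%fset | j <- enum 'I_m] ++
  [seq [fset e ord_max; - e (w j)]%fset | j <- enum 'I_m].
have <- : size L = (3 * m)%N.
  by rewrite /L 2!size_cat 3!size_map size_enum_ord; clear; lia.
have XP x : x \in X -> x = e ord_max \/ exists j, x = e (w j) \/ x = - e (w j).
  move=> /cross_setP[[i|j] ->]; last by right; exists j; right.
  have [im|im] := ltnP i m; last first.
    by left; congr (delta_mx 0 _); apply: val_inj => /=; move: (ltn_ord i) im; clear; lia.
  by right; exists (Ordinal im); left; congr (delta_mx 0 _); apply: val_inj.
have wX j : e (w j) \in X /\ - e (w j) \in X.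
  by split; apply/cross_setP; [exists (inl (w j))|exists (inr j)].
have inL (x y : 'rV[R]_m.+1) : x != y -> x = e ord_max -> y \in X -> [fset x; y]%fset \in L.
  move=> xy xE yX; case: (XP y yX) => [yE|[j [->|->]]]; first by rewrite xE yE eqxx in xy.
    rewrite xE !mem_cat; apply/or3P; apply: Or32.
    by apply/mapP; exists j; rewrite ?mem_enum.
  rewrite xE !mem_cat; apply/or3P; apply: Or33.
  by apply/mapP; exists j; rewrite ?mem_enum.
rewrite /sa; apply: uniq_leq_size; first exact: fset_uniq.
move=> Y; rewrite !inE => /andP[_ /asboolP[x [y [-> sxy]]]].
have /strictly_antipodalP[xX yX xy _] := sxy.
case: (XP x xX) => [xE|[i xE]]; first exact: inL.
case: (XP y yX) => [yE|[j yE]]; first by rewrite fsetUC; apply: inL; rewrite // eq_sym.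
have NX (z : 'rV[R]_m.+1) l : z = e (w l) \/ z = - e (w l) -> - z \in X.
  by case=> ->; rewrite ?opprK; case: (wX l).
have -> := antipodal_symmetric (NX x i xE) (NX y j yE) sxy.
rewrite !mem_cat; apply/or3P; apply: Or31; apply/mapP; exists i; rewrite ?mem_enum //.
by case: xE => ->; rewrite ?opprK // fsetUC.
Qed.

(** * The minimum over the family *)

Lemma min_natP (S : set nat) : S !=set0 ->
  S (min_nat S) /\ forall n, S n -> (min_nat S <= n)%N.
Proof.
move=> [n0 Sn0]; suff : (S `&` lbound S) (min_nat S) by [].
apply: xgetPex; have exS : exists n, `[< S n >] by exists n0; apply/asboolP.
case: (ex_minnP exS) => n /asboolP Sn nmin; exists n; split=> // k Sk.
by apply: nmin; apply/asboolP.
Qed.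

Theorem theorem2p15 (R : realType) (d : nat) (hd : (2 <= d)%N) :
  (forall k : nat, (1 <= k)%N -> (k <= d - 1)%N ->
     (3 * (d - 1) <= min_sa R d (d + k))%N) /\
  min_sa R d (2 * d - 1) = (3 * (d - 1))%N.
Proof.
have lower k : (1 <= k)%N -> (k <= d - 1)%N -> (3 * (d - 1) <= min_sa R d (d + k))%N.
  move=> k1 kd; have kd' : (k <= d)%N by move: kd; clear; lia.
  (* The cross set shows that the family is nonempty, so the minimum is attained instead of
     defaulting to 0. *)
  rewrite /min_sa; have [|[X XC <-] _] := @min_natP [set sa X | X in @Cs R d (d + k)].
    by exists (sa (cross_set R kd')), (cross_set R kd') => //; exact: cross_set_Cs.
  exact: sa_ge kd hd XC.
split=> //; apply/eqP; rewrite eqn_leq.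
have -> : (2 * d - 1 = d + (d - 1))%N by move: hd; clear; lia.
rewrite lower ?andbT //; last by move: hd; clear; lia.
case: d hd {lower} => [//|m] hd; rewrite subSS subn0.
have XC : Cs (m.+1 + m) (cross_set R (leqnSn m)) by apply: cross_set_Cs.
apply: leq_trans (sa_cross_set R m).
have [|_] := @min_natP [set sa X | X in @Cs R m.+1 (m.+1 + m)]; last first.
  by apply; exists (cross_set R (leqnSn m)).
by exists (sa (cross_set R (leqnSn m))), (cross_set R (leqnSn m)).
Qed.
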